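(* Let $\mathcal{C}$ be a unital C*-algebra and $\alpha:\mathcal{C}\to\mathcal{C}$ a *-morphism. Let $(H_0,\sigma)$ be a faithful *-representation of $\mathcal{C}$ such that the induced *-morphism $\beta:\sigma(\mathcal{C})\to\sigma(\mathcal{C})$, $\beta(\sigma(x))=\sigma(\alpha(x))$, is implemented by a unitary $w\in\mathcal{B}(H_0)$, i.e. $\sigma(\alpha(x))=w\sigma(x)w^*$ for all $x\in\mathcal{C}$. Then $\overline{lt_\sigma(\mathbb{Z}_+\times_\alpha\mathcal{C})}^{\,\mathrm{w}^*}\subseteq\mathcal{B}(H_0\otimes\ell^2(\mathbb{Z}_+))$ is reflexive.
   Context: Let $\mathbb{Z}_+=\{0,1,2,\dots\}$, $(e_n)_{n\ge0}$ the standard basis of $\ell^2(\mathbb{Z}_+)$, $v$ the unilateral shift $ve_n=e_{n+1}$, $V=1_{H_0}\otimes v$, and $\widetilde{\sigma}(x)(\xi\otimes e_n)=\sigma(\alpha^n(x))\xi\otimes e_n$ for $x\in\mathcal{C}$. The representation $lt_\sigma$ of the left semicrossed product $\mathbb{Z}_+\times_\alpha\mathcal{C}$ is the one determined by $lt_\sigma(\sum_{n=0}^k\delta_n\otimes x_n)=\sum_{n=0}^kV^n\widetilde{\sigma}(x_n)$; hence the w*-closure of its image is the w*-closed linear span of the operators $\sum_{n=0}^kV^n\widetilde{\sigma}(x_n)$, $x_n\in\mathcal{C}$, $k\ge0$. (The left semicrossed product is the completion of the algebra of finite sums $\sum\delta_n\otimes x_n$, with $(\delta_n\otimes x)(\delta_m\otimes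 y)=\delta_{n+m}\otimes\alpha^m(x)y$, under the supremum of the norms $\|\sum T^n\pi(x_n)\|$ over all pairs of a *-representation $\pi$ of $\mathcal{C}$ and a contraction $T$ with $\pi(x)T=T\pi(\alpha(x))$.) A subspace $\mathcal{S}\subseteq\mathcal{B}(L)$, $L$ a Hilbert space, is reflexive if it equals $\mathrm{Ref}(\mathcal{S})=\{T\in\mathcal{B}(L):T\xi\in\overline{\mathcal{S}\xi}\text{ for all }\xi\in L\}$. *)

(* Defs.v *)
From HB Require Import structures.
From mathcomp Require Import all_boot all_order all_algebra.
From mathcomp Require Import complex.
From mathcomp Require Import boolp classical_sets functions reals topology normedtype sequences.
From mathcomp Require Import ring lra.
Set Implicit Arguments.
Unset Strict Implicit.
Unset Printing Implicit Defensive.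
Import Order.TTheory GRing.Theory Num.Theory.
Import numFieldNormedType.Exports.
Local Open Scope classical_set_scope.
Local Open Scope ring_scope.
Local Open Scope complex_scope.

HB.mixin Record CompleteNormedModule_isHilbert (R : realType) H
    & CompleteNormedModule R[i] H := {
  hdot : H -> H -> R[i] ;
  hdotPl : forall a x y z, hdot (a *: x + y) z = a * hdot x z + hdot y z ;
  hdotC : forall x y, hdot y x = (hdot x y)^* ;
  hdot_norm : forall x, hdot x x = `|x| ^+ 2 }.

(* The inner product is linear in the first variable. *)
#[short(type="hilbertType")]
HB.structure Definition Hilbert (R : realType) :=
  {H of CompleteNormedModule R[i] H & CompleteNormedModule_isHilbert R H}.

HB.mixin Record CompleteNormedModule_isCStar (R : realType) A
    & CompleteNormedModule R[i] A := {
  cmul : A -> A -> A ;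
  cone : A ;
  star : A -> A ;
  cmulA : forall x y z, cmul x (cmul y z) = cmul (cmul x y) z ;
  cmul1l : forall x, cmul cone x = x ;
  cmul1r : forall x, cmul x cone = x ;
  cmulPl : forall a x y z, cmul (a *: x + y) z = a *: cmul x z + cmul y z ;
  cmulPr : forall a x y z, cmul z (a *: x + y) = a *: cmul z x + cmul z y ;
  starP : forall a x y, star (a *: x + y) = a^* *: star x + star y ;
  starM : forall x y, star (cmul x y) = cmul (star y) (star x) ;
  starK : forall x, star (star x) = x ;
  cnormM : forall x y, `|cmul x y| <= `|x| * `|y| ;
  cnorm_star : forall x, `|cmul (star x) x| = `|x| ^+ 2 }.

(* Unital C*-algebras. The product is part of the mixin because the library
   hierarchy allows no common extension of its rings and its normed modules;
   1 = 0 is not excluded. *)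
#[short(type="cstarType")]
HB.structure Definition CStar (R : realType) :=
  {A of CompleteNormedModule R[i] A & CompleteNormedModule_isCStar R A}.

(* Norms in a normedModType R[i] are elements of R[i]; rnorm is the norm as a
   real number. *)
Section RealNorm.
Variables (R : realType) (V : normedModType R[i]).
Implicit Types x y : V.

Definition rnorm x : R := complex.Re `|x|.

Lemma rnormE x : `|x| = (rnorm x)%:C.
Proof.
have := normr_ge0 x; rewrite lecE /rnorm /= => /andP[/eqP h _].
by case: `|x| h => a b /= ->.
Qed.

Lemma rnorm_ge0 x : 0 <= rnorm x.
Proof. by have := normr_ge0 x; rewrite rnormE lecR. Qed.

Lemma rnormD x y : rnorm (x + y) <= rnorm x + rnorm y.
Proof. by have := ler_normD x y; rewrite !rnormE -rmorphD lecR. Qed.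

Lemma rnormZ (a : R[i]) x : rnorm (a *: x) = complex.Re `|a| * rnorm x.
Proof.
have := normrZ a x.
rewrite !rnormE (_ : `|a| = (complex.Re `|a|)%:C); last by case: a.
by rewrite -rmorphM => -[].
Qed.

Lemma rnormN x : rnorm (- x) = rnorm x.
Proof. by rewrite /rnorm normrN. Qed.

Lemma rnorm0 : rnorm 0 = 0.
Proof. by rewrite /rnorm normr0. Qed.

Lemma rnorm0_eq0 x : rnorm x = 0 -> x = 0.
Proof. by move=> h; apply/normr0_eq0; rewrite rnormE h. Qed.

Lemma rnorm_lip x y : `|rnorm x - rnorm y| <= rnorm (x - y).
Proof.
have h1 := rnormD (x - y) y; have h2 := rnormD (y - x) x.
rewrite !subrK -(opprB x y) rnormN in h1 h2.
by rewrite ler_norml; apply/andP; split; lra.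
Qed.

Lemma cvg_rnorm (T : Type) (F : set_system T) (FF : Filter F) (f : T -> V) (l : V) :
  f @ F --> l -> (fun t => rnorm (f t)) @ F --> rnorm l.
Proof.
move=> /cvgrPdist_lt fl; apply/cvgrPdist_lt => e e0.
have /fl : 0 < e%:C by rewrite ltcR.
apply: filterS => t; rewrite rnormE ltcR.
exact: le_lt_trans (rnorm_lip _ _).
Qed.
End RealNorm.

Section Dot.
Variables (R : realType) (H : hilbertType R).
Implicit Types x y : H.
Local Notation hd := (@hdot R H).

Lemma hdotDl x y z : hd (x + y) z = hd x z + hd y z.
Proof. by rewrite -[x]scale1r hdotPl mul1r scale1r. Qed.
Lemma hdot0l z : hd 0 z = 0.
Proof. by apply: (addrI (hd 0 z)); rewrite -hdotDl !addr0. Qed.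
Lemma hdotZl a x z : hd (a *: x) z = a * hd x z.
Proof. by rewrite -[a *: x]addr0 hdotPl hdot0l addr0. Qed.
Lemma hdotDr z x y : hd z (x + y) = hd z x + hd z y.
Proof. by rewrite hdotC hdotDl rmorphD /= -!hdotC. Qed.
Lemma hdotZr z a x : hd z (a *: x) = a^* * hd z x.
Proof. by rewrite hdotC hdotZl rmorphM /= -hdotC. Qed.

Lemma Re_hdot x y :
  complex.Re (hd x y) = 2^-1 * (rnorm (x + y) ^+ 2 - rnorm x ^+ 2 - rnorm y ^+ 2).
Proof.
have h (z : H) : rnorm z ^+ 2 = complex.Re (hd z z).
  by rewrite hdot_norm rnormE -rmorphXn.
rewrite !h hdotDl !hdotDr (hdotC x y).
by case: (hd x y) => a b; case: (hd x x) => c d; case: (hd y y) => e f /=; field.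
Qed.

Lemma Im_hdot x y : complex.Im (hd x y) = complex.Re (hd x ('i *: y)).
Proof. by rewrite hdotZr; case: (hd x y) => a b /=; ring. Qed.
End Dot.

(* The Hilbert space ell2 H of square-summable sequences in H is the model used
   for H (x) l^2(Z_+): an elementary tensor xi (x) a is the sequence
   n |-> a_n *: xi. *)
Section Ell2.
Variables (R : realType) (H : hilbertType R).

Definition sq_summable (f : nat -> H) : Prop :=
  cvgn (series (fun n => rnorm (f n) ^+ 2)).

Definition ell2_pred : {pred nat -> H} := fun f => `[< sq_summable f >].

Record ell2 := Ell2 { ell2_seq :> nat -> H ; ell2P : ell2_seq \in ell2_pred }.

HB.instance Definition _ := [isSub for ell2_seq].
HB.instance Definition _ := [Choice of ell2 by <:].

Lemma sq_summable_le (f : nat -> H) (M : R) :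
  (forall N, \sum_(0 <= k < N) rnorm (f k) ^+ 2 <= M) -> sq_summable f.
Proof.
move=> h; apply: nondecreasing_is_cvgn.
  by apply/nondecreasing_seqP => n; rewrite /series/= big_nat_recr//= lerDl sqr_ge0.
by exists M => _ [n _ <-]; exact: h.
Qed.

Definition nsq (f : nat -> H) : R := limn (series (fun n => rnorm (f n) ^+ 2)).

Lemma nsq_ge f N : sq_summable f -> \sum_(0 <= k < N) rnorm (f k) ^+ 2 <= nsq f.
Proof.
move=> sf; apply: (nondecreasing_cvgn_le _ sf).
by apply/nondecreasing_seqP => n; rewrite /series/= big_nat_recr//= lerDl sqr_ge0.
Qed.

Lemma nsq_ge0 f : sq_summable f -> 0 <= nsq f.
Proof. by move=> /(nsq_ge 0); rewrite big_geq. Qed.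

Lemma nsq_le f M : (forall N, \sum_(0 <= k < N) rnorm (f k) ^+ 2 <= M) -> nsq f <= M.
Proof.
move=> h; apply: limr_le; first exact: sq_summable_le h.
by apply: nearW => n; exact: h.
Qed.

Lemma summ_addt f g (t : R) : 0 < t < 1 ->
  sq_summable f -> sq_summable g -> forall N,
  \sum_(0 <= k < N) rnorm ((f + g) k) ^+ 2 <= nsq f / t + nsq g / (1 - t).
Proof.
move=> /andP[t0 t1] sf sg N.
have t2 : 0 < 1 - t by rewrite subr_gt0.
apply: (@le_trans _ _ (\sum_(0 <= k < N) (rnorm (f k) ^+ 2 / t + rnorm (g k) ^+ 2 / (1 - t)))).
  apply: ler_sum => k _.
  have h := rnormD (f k) (g k); have h0 := rnorm_ge0 ((f + g) k).
  apply: (@le_trans _ _ ((rnorm (f k) + rnorm (g k)) ^+ 2)).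
    by rewrite ler_sqr ?nnegrE ?(le_trans h0 h).
  rewrite -subr_ge0.
  set a := rnorm (f k); set b := rnorm (g k).
  have -> : a ^+ 2 / t + b ^+ 2 / (1 - t) - (a + b) ^+ 2
     = (a * (1 - t) - b * t) ^+ 2 / (t * (1 - t)).
    by field; rewrite !gt_eqF.
  by rewrite divr_ge0 ?sqr_ge0// mulr_ge0// ltW.
rewrite big_split /= -!mulr_suml.
by apply: lerD; rewrite ler_wpM2r ?invr_ge0 ?(ltW t0) ?(ltW t2)//; exact: nsq_ge.
Qed.

Lemma sq_summableD f g : sq_summable f -> sq_summable g -> sq_summable (f + g).
Proof.
move=> sf sg; apply: sq_summable_le; apply: (summ_addt (t := 2^-1)) => //.
by rewrite invr_gt0 ltr0n /= invf_lt1// ltr1n.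
Qed.

Lemma nsqZ_term (a : R[i]) (f : nat -> H) :
  (fun n => rnorm ((a *: f) n) ^+ 2) = (complex.Re `|a| ^+ 2) *: (fun n => rnorm (f n) ^+ 2).
Proof. by apply/funext => n /=; rewrite rnormZ exprMn. Qed.

Lemma sq_summableZ (a : R[i]) f : sq_summable f -> sq_summable (a *: f).
Proof. by rewrite /sq_summable nsqZ_term => sf; apply: is_cvg_seriesZ. Qed.

Lemma nsqZ a f : sq_summable f -> nsq (a *: f) = complex.Re `|a| ^+ 2 * nsq f.
Proof. by move=> sf; rewrite /nsq nsqZ_term lim_seriesZ. Qed.

Lemma sq_summable0 : sq_summable 0.
Proof.
by apply: (@sq_summable_le _ 0) => N; rewrite big1// => k _; rewrite rnorm0 expr0n.
Qed.

Lemma ell2_submod : GRing.submod_closed ell2_pred.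
Proof.
split; first by apply/asboolP/sq_summable0.
by move=> a f g /asboolP sf /asboolP sg; apply/asboolP/sq_summableD => //; apply: sq_summableZ.
Qed.
HB.instance Definition _ := GRing.isSubmodClosed.Build R[i] (nat -> H) ell2_pred ell2_submod.
HB.instance Definition _ := [SubChoice_isSubLmodule of ell2 by <:].

Lemma ell2_summable (f : ell2) : sq_summable f.
Proof. exact/asboolP/ell2P. Qed.
Arguments ell2_summable : clear implicits.

Definition ell2_norm (f : ell2) : R[i] := (Num.sqrt (nsq f))%:C.

Lemma nsq_eq0 f : sq_summable f -> nsq f = 0 -> f = 0.
Proof.
move=> sf f0; apply/funext => k; apply: rnorm0_eq0; apply/eqP.
rewrite -sqrf_eq0 eq_le sqr_ge0 andbT -f0 (le_trans _ (nsq_ge k.+1 sf))//.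
by rewrite big_nat_recr//= lerDr sumr_ge0// => i _; rewrite sqr_ge0.
Qed.

Lemma ell2_norm0 f : ell2_norm f = 0 -> f = 0.
Proof.
move=> [/eqP]; rewrite sqrtr_eq0 => f0; apply: val_inj; apply: nsq_eq0.
  exact: ell2_summable.
by apply/eqP; rewrite eq_le f0 nsq_ge0//; exact: ell2_summable.
Qed.

Lemma ell2_normD f g : ell2_norm (f + g) <= ell2_norm f + ell2_norm g.
Proof.
have sf := ell2_summable f; have sg := ell2_summable g.
have [f0|fn0] := eqVneq (nsq f) 0.
  have -> : f = 0 by apply: val_inj; exact: nsq_eq0.
  by rewrite add0r lerDr ler0c sqrtr_ge0.
have [g0|gn0] := eqVneq (nsq g) 0.
  have -> : g = 0 by apply: val_inj; exact: nsq_eq0.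
  by rewrite addr0 lerDl ler0c sqrtr_ge0.
rewrite /ell2_norm -rmorphD lecR.
set A := Num.sqrt (nsq f); set B := Num.sqrt (nsq g).
have A0 : 0 < A by rewrite sqrtr_gt0 lt_neqAle eq_sym fn0 nsq_ge0.
have B0 : 0 < B by rewrite sqrtr_gt0 lt_neqAle eq_sym gn0 nsq_ge0.
have AB0 : 0 < A + B by rewrite addr_gt0.
rewrite -[leRHS]gtr0_norm// -sqrtr_sqr ler_wsqrtr//.
apply: nsq_le => N.
have t01 : 0 < A / (A + B) < 1.
  by rewrite divr_gt0// ltr_pdivrMr// mul1r ltrDl.
have := summ_addt t01 sf sg N; congr (_ <= _).
rewrite -(sqr_sqrtr (nsq_ge0 sf)) -(sqr_sqrtr (nsq_ge0 sg)) -/A -/B.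
by field; rewrite !gt_eqF// (_ : A + B - A = B)//; ring.
Qed.

Lemma ell2_normZ (a : R[i]) f : ell2_norm (a *: f) = `|a| * ell2_norm f.
Proof.
rewrite /ell2_norm nsqZ; last exact: ell2_summable.
have a0 : 0 <= complex.Re `|a| by case: a => x y /=; rewrite sqrtr_ge0.
rewrite sqrtrM ?sqr_ge0// sqrtr_sqr ger0_norm// rmorphM /=; by congr (_ * _); case: a {a0}.
Qed.

HB.instance Definition _ :=
  Lmodule_isNormed.Build R[i] ell2 ell2_normD ell2_normZ ell2_norm0.

Lemma ell2_rnormE (f : ell2) : rnorm f = Num.sqrt (nsq f).
Proof. by []. Qed.

Lemma ell2_sum_le (f : ell2) N : \sum_(0 <= k < N) rnorm (f k) ^+ 2 <= rnorm f ^+ 2.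
Proof.
by rewrite ell2_rnormE sqr_sqrtr ?nsq_ge0 ?nsq_ge//; exact: ell2_summable.
Qed.

Lemma ell2_coord_le (f : ell2) n : rnorm (f n) <= rnorm f.
Proof.
rewrite -ler_sqr ?nnegrE ?rnorm_ge0// (le_trans _ (ell2_sum_le f n.+1))//.
by rewrite big_nat_recr//= lerDr sumr_ge0// => i _; rewrite sqr_ge0.
Qed.

Lemma ell2_rnorm_le (f : ell2) (M : R) : 0 <= M ->
  (forall N, \sum_(0 <= k < N) rnorm (f k) ^+ 2 <= M ^+ 2) -> rnorm f <= M.
Proof.
move=> M0 h; rewrite ell2_rnormE -[leRHS]ger0_norm// -sqrtr_sqr ler_wsqrtr//.
exact: nsq_le.
Qed.

Lemma ell2_complete (F : set_system ell2) : ProperFilter F -> cauchy F -> cvg F.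
Proof.
move=> FF /cauchyP Fc.
have FB (e : R) : 0 < e -> exists x : ell2, F [set y | rnorm (x - y) < e].
  move=> e0; have [|x Fx] := Fc e%:C; first by rewrite ltcR.
  exists x; apply: filterS Fx => y; rewrite -ball_normE /= rnormE ltcR.
  by [].
have coord n : cvg ((fun f : ell2 => f n) @ F).
  apply: cauchy_cvg; apply: cauchy_exP => -[e i].
  rewrite ltcE /= => /andP[/eqP -> e0].
  have [x Fx] := FB _ e0; exists (x n); apply: filterS Fx => y xy.
  rewrite -ball_normE /= rnormE ltcR.
  by apply: le_lt_trans xy; exact: (ell2_coord_le (x - y) n).
pose y n := lim ((fun f : ell2 => f n) @ F).
have yE n : (fun f : ell2 => f n) @ F --> y n by exact: coord.
have key (x : ell2) (e : R) N : F [set z | rnorm (x - z) < e] ->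
    \sum_(0 <= k < N) rnorm (x k - y k) ^+ 2 <= e ^+ 2.
  move=> Fx.
  have cv M : (fun z : ell2 => \sum_(0 <= k < M) rnorm (x k - z k) ^+ 2) @ F -->
      \sum_(0 <= k < M) rnorm (x k - y k) ^+ 2.
    elim: M => [|M IH].
      rewrite (_ : (fun z : ell2 => _) = cst (0 : R)).
        by rewrite big_geq//; exact: cvg_cst.
      by apply/funext => z; rewrite big_geq.
    rewrite (_ : (fun z : ell2 => _) = (fun z : ell2 =>
       \sum_(0 <= k < M) rnorm (x k - z k) ^+ 2 + rnorm (x M - z M) * rnorm (x M - z M))).
      rewrite big_nat_recr//=; apply: cvgD => //.
      by apply: cvgM; apply: cvg_rnorm; apply: cvgB => //; exact: cvg_cst.
    by apply/funext => z; rewrite big_nat_recr.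
  apply: (cvgr_to_le (cv N)).
  apply: filterS Fx => z /= xz.
  apply: (le_trans (ell2_sum_le (x - z) N)).
  by rewrite ler_sqr ?nnegrE ?rnorm_ge0 ?ltW// (le_lt_trans _ xz) ?rnorm_ge0.
have ys : y \in ell2_pred.
  have [x Fx] := FB 1 ltr01.
  have xy : (x : nat -> H) - y \in ell2_pred.
    by apply/asboolP; apply: (@sq_summable_le _ 1) => N; rewrite -[leRHS](expr1n _ 2); exact: key.
  rewrite -[y](subKr (x : nat -> H)); apply: rpredB => //; exact: ell2P.
apply/cvg_ex; exists (Ell2 ys); apply/cvgrPdist_lt => -[e i].
rewrite ltcE /= => /andP[/eqP -> e0].
have e20 : 0 < e / 2 by rewrite divr_gt0.
have [x Fx] := FB _ e20; apply: filterS (Fx) => z /= xz.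
rewrite rnormE ltcR.
have h : rnorm (x - Ell2 ys) <= e / 2.
  by apply: ell2_rnorm_le; [exact: ltW|move=> N; exact: key].
rewrite -(subrK x (Ell2 ys)) -addrA (le_lt_trans (rnormD _ _))//.
by rewrite -(opprB x) rnormN [ltRHS](splitr e) ler_ltD.
Qed.
HB.instance Definition _ := Uniform_isComplete.Build ell2 ell2_complete.

(* The sum of a complex series, taken on real and imaginary parts. *)
Definition csum (u : nat -> R[i]) : R[i] :=
  Complex (limn (series (fun n => complex.Re (u n))))
          (limn (series (fun n => complex.Im (u n)))).

Definition ell2_dot (f g : ell2) : R[i] := csum (fun n => hdot (f n) (g n)).

Lemma cvg_Re_dot (f g : ell2) :
  cvgn (series (fun n => complex.Re (hdot (f n) (g n)))).
Proof.
have -> : (fun n => complex.Re (hdot (f n) (g n))) = 2^-1 *: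
   ((fun n => rnorm ((f + g) n) ^+ 2) - (fun n => rnorm (f n) ^+ 2)
    - (fun n => rnorm (g n) ^+ 2)).
  by apply/funext => n; rewrite Re_hdot.
apply: is_cvg_seriesZ; apply: is_cvg_seriesB; last exact: ell2_summable.
by apply: is_cvg_seriesB; exact: ell2_summable.
Qed.

Lemma cvg_Im_dot (f g : ell2) :
  cvgn (series (fun n => complex.Im (hdot (f n) (g n)))).
Proof.
have -> : (fun n => complex.Im (hdot (f n) (g n))) =
    (fun n => complex.Re (hdot (f n) (('i *: g) n))).
  by apply/funext => n; rewrite Im_hdot.
exact: cvg_Re_dot.
Qed.

Arguments cvg_Re_dot : clear implicits.
Arguments cvg_Im_dot : clear implicits.

Lemma ell2_dotPl a f g h : ell2_dot (a *: f + g) h = a * ell2_dot f h + ell2_dot g h.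
Proof.
case: a => a b; apply/eqP; rewrite eq_complex /=; apply/andP; split; apply/eqP.
- transitivity (limn (series (a *: (fun n => complex.Re (hdot (f n) (h n))) -
       b *: (fun n => complex.Im (hdot (f n) (h n))) +
       (fun n => complex.Re (hdot (g n) (h n)))))).
    congr (limn (series _)); apply/funext => n /=; rewrite hdotPl.
    rewrite -[RHS]/(a * complex.Re (hdot (f n) (h n)) -
      b * complex.Im (hdot (f n) (h n)) + complex.Re (hdot (g n) (h n))).
    by case: (hdot (f n) (h n)) (hdot (g n) (h n)) => x y [z t].
  have h1 := is_cvg_seriesZ (k := a) (cvg_Re_dot f h).
  have h2 := is_cvg_seriesZ (k := b) (cvg_Im_dot f h).
  rewrite lim_seriesD; [|exact: is_cvg_seriesB|exact: cvg_Re_dot].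
  by rewrite lim_seriesB// !lim_seriesZ; [|exact: cvg_Im_dot|exact: cvg_Re_dot].
- transitivity (limn (series (a *: (fun n => complex.Im (hdot (f n) (h n))) +
       b *: (fun n => complex.Re (hdot (f n) (h n))) +
       (fun n => complex.Im (hdot (g n) (h n)))))).
    congr (limn (series _)); apply/funext => n /=; rewrite hdotPl.
    rewrite -[RHS]/(a * complex.Im (hdot (f n) (h n)) +
      b * complex.Re (hdot (f n) (h n)) + complex.Im (hdot (g n) (h n))).
    by case: (hdot (f n) (h n)) (hdot (g n) (h n)) => x y [z t].
  have h1 := is_cvg_seriesZ (k := a) (cvg_Im_dot f h).
  have h2 := is_cvg_seriesZ (k := b) (cvg_Re_dot f h).
  rewrite lim_seriesD; [|exact: is_cvg_seriesD|exact: cvg_Im_dot].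
  by rewrite lim_seriesD// !lim_seriesZ; [|exact: cvg_Re_dot|exact: cvg_Im_dot].
Qed.

Lemma ell2_dotC f g : ell2_dot g f = (ell2_dot f g)^*.
Proof.
apply/eqP; rewrite eq_complex /=; apply/andP; split; apply/eqP.
  by congr (limn (series _)); apply/funext => n; rewrite hdotC; case: hdot.
rewrite -lim_seriesN; last exact: cvg_Im_dot.
congr (limn (series _)); apply/funext => n; rewrite hdotC.
rewrite -[RHS]/(- complex.Im (hdot (f n) (g n))).
by case: (hdot (f n) (g n)).
Qed.

Lemma ell2_dot_norm f : ell2_dot f f = `|f| ^+ 2.
Proof.
rewrite rnormE -rmorphXn /= ell2_rnormE sqr_sqrtr; last first.
  exact/nsq_ge0/ell2_summable.
apply/eqP; rewrite eq_complex /=; apply/andP; split; apply/eqP.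
  congr (limn (series _)); apply/funext => n; rewrite hdot_norm rnormE -rmorphXn; reflexivity.
rewrite (_ : (fun n => _) = 0); last first.
  apply/funext => n; rewrite hdot_norm rnormE -rmorphXn; reflexivity.
rewrite (_ : series 0 = cst 0); first exact: lim_cst.
by apply/funext => n; rewrite /series /= big1.
Qed.

HB.instance Definition _ := CompleteNormedModule_isHilbert.Build R ell2 ell2_dotPl ell2_dotC ell2_dot_norm.
End Ell2.

Section Operators.
Variable R : realType.

(* The elements of B(H, K), as plain functions. *)
Definition bounded_op (H K : hilbertType R) (T : H -> K) : Prop :=
  linear T /\ continuous T.

Definition contraction_op (H : hilbertType R) (T : H -> H) : Prop :=
  linear T /\ forall xi, `|T xi| <= `|xi|.

(* ws is the adjoint of the unitary w. *)
Definition unitary_op (H : hilbertType R) (w ws : H -> H) : Prop :=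
  [/\ bounded_op w, bounded_op ws,
      forall xi eta, hdot (w xi) eta = hdot xi (ws eta),
      cancel w ws & cancel ws w].

Definition star_morphism (A B : cstarType R) (alpha : A -> B) : Prop :=
  [/\ linear alpha,
      forall x y, alpha (cmul x y) = cmul (alpha x) (alpha y) &
      forall x, alpha (star x) = star (alpha x)].

Definition star_rep (A : cstarType R) (H : hilbertType R)
    (pi : A -> H -> H) : Prop :=
  [/\ forall x, bounded_op (pi x),
      forall a x y xi, pi (a *: x + y) xi = a *: pi x xi + pi y xi,
      forall x y xi, pi (cmul x y) xi = pi x (pi y xi) &
      forall x xi eta, hdot (pi (star x) xi) eta = hdot xi (pi x eta)].

Section Reflexivity.
Variable L : hilbertType R.
Implicit Type S : set (L -> L).

Definition Ref S : set (L -> L) :=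
  [set T | bounded_op T /\
           forall xi, closure [set A xi | A in S] (T xi)].

Definition reflexive_space S : Prop := S = Ref S.

(* The normal functionals T |-> sum_i <T xi_i, eta_i>, with (xi_i) and (eta_i)
   square-summable, are those given by the predual (the trace class). *)
Definition normal_functional (xi eta : ell2 L) (T : L -> L) : R[i] :=
  csum (fun i => hdot (T (xi i)) (eta i)).

Definition wstar_closure S : set (L -> L) :=
  [set T | bounded_op T /\
     forall (n : nat) (xi eta : 'I_n -> ell2 L) (e : R), 0 < e ->
       exists2 A, S A & forall j : 'I_n,
         `|normal_functional (xi j) (eta j) T
           - normal_functional (xi j) (eta j) A| < e%:C ].
End Reflexivity.

Section Ell2Operators.
Variable H : hilbertType R.

(* [insubd 0 f] is f as an element of ell2 H if f is square-summable, and 0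
   otherwise. *)
Definition basis_tensor (xi : H) (n : nat) : ell2 H :=
  insubd (0 : ell2 H) (fun m => if m == n then xi else 0).

Definition ushift (f : ell2 H) : ell2 H :=
  insubd (0 : ell2 H) (fun n => if n is m.+1 then f m else 0).

Definition diag_op (A : nat -> H -> H) (f : ell2 H) : ell2 H :=
  insubd (0 : ell2 H) (fun n => A n (f n)).

Lemma insubd_ell2E (f : nat -> H) : sq_summable f -> insubd (0 : ell2 H) f = f :> (nat -> H).
Proof. by move=> sf; rewrite (insubdK _ (asboolT sf : f \in @ell2_pred R H)). Qed.

Lemma basis_tensorE xi n m : basis_tensor xi n m = if m == n then xi else 0.
Proof.
rewrite insubd_ell2E//; apply: (@sq_summable_le _ _ _ (rnorm xi ^+ 2)) => N.
have [nN|Nn] := ltnP n N; last first.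
  rewrite big_nat big1 ?sqr_ge0// => i /andP[_ iN].
  by rewrite ltn_eqF ?(leq_trans iN)// rnorm0 expr0n.
rewrite (big_cat_nat (n := n)) ?(ltnW nN)//= big_nat big1 ?add0r.
  rewrite big_ltn// eqxx big_nat big1 ?addr0// => i /andP[ni _].
  by rewrite gtn_eqF// rnorm0 expr0n.
by move=> i /andP[_ ni]; rewrite ltn_eqF// rnorm0 expr0n.
Qed.

Lemma ushiftE f n : ushift f n = if n is m.+1 then f m else 0.
Proof.
rewrite insubd_ell2E//; apply: (@sq_summable_le _ _ _ (rnorm f ^+ 2)) => -[|N].
  by rewrite big_geq// sqr_ge0.
by rewrite big_nat_recl//= rnorm0 expr0n add0r; exact: ell2_sum_le.
Qed.

Lemma diag_opE A (M : R) f n : (forall k xi, rnorm (A k xi) <= M * rnorm xi) ->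
  diag_op A f n = A n (f n).
Proof.
move=> AM; rewrite insubd_ell2E//.
apply: (@sq_summable_le _ _ _ (M ^+ 2 * rnorm f ^+ 2)) => N.
apply: (@le_trans _ _ (\sum_(0 <= k < N) M ^+ 2 * rnorm (f k) ^+ 2)).
  apply: ler_sum => k _; rewrite -exprMn ler_sqr ?nnegrE ?rnorm_ge0//.
  exact: le_trans (rnorm_ge0 _) (AM _ _).
by rewrite -mulr_sumr ler_wpM2l ?sqr_ge0//; exact: ell2_sum_le.
Qed.

Lemma ushift_basis xi n : ushift (basis_tensor xi n) = basis_tensor xi n.+1.
Proof.
apply: val_inj; apply/funext => -[|m].
  by rewrite [LHS]ushiftE [RHS]basis_tensorE.
by rewrite [LHS]ushiftE [RHS]basis_tensorE basis_tensorE.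
Qed.

Lemma diag_op_basis A xi n : (forall k, A k 0 = 0) ->
  diag_op A (basis_tensor xi n) = basis_tensor (A n xi) n.
Proof.
move=> A0; congr (insubd _ _); apply/funext => m.
by rewrite basis_tensorE; case: eqP => [->|].
Qed.
End Ell2Operators.

Section SemicrossedProduct.
Variables (A : cstarType R) (alpha : A -> A).
Implicit Types a b : seq A.

(* A finite sum sum_n delta_n (x) x_n is represented by the sequence
   [:: x_0; x_1; ...; x_k]; trailing zeros are irrelevant. *)
Definition fsum_sub a b : seq A :=
  mkseq (fun n => a`_n - b`_n) (maxn (size a) (size b)).

Definition covariant_pair (K : hilbertType R) (pi : A -> K -> K)
    (T : K -> K) : Prop :=
  [/\ star_rep pi, contraction_op T &
      forall x xi, pi x (T xi) = T (pi (alpha x) xi)].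

Definition integrated (K : hilbertType R) (pi : A -> K -> K) (T : K -> K) a
    (xi : K) : K :=
  \sum_(n < size a) iter n T (pi a`_n xi).

(* The norm of the left semicrossed product is the least c with this property. *)
Definition semicrossed_norm_le a (c : R) : Prop :=
  forall (K : hilbertType R) (pi : A -> K -> K) (T : K -> K),
    covariant_pair pi T ->
    forall xi, `|integrated pi T a xi| <= c%:C * `|xi|.

Variables (H0 : hilbertType R) (sigma : A -> H0 -> H0).

(* The sequences n |-> sigma (alpha^n x) (f n) are square-summable since
   sigma \o alpha^n is contractive. *)
Definition sigma_tilde (x : A) : ell2 H0 -> ell2 H0 :=
  diag_op (fun n => sigma (iter n alpha x)).

Definition lt_fsum a : ell2 H0 -> ell2 H0 :=
  integrated sigma_tilde (@ushift H0) a.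

(* The image of the left semicrossed product under lt_sigma. An element of the
   completion is given by a sequence (a_k) of finite sums which is Cauchy for
   the norm above, and lt_sigma maps it to the norm limit of lt_fsum a_k. *)
Definition lt_image : set (ell2 H0 -> ell2 H0) :=
  [set T | bounded_op T /\ exists a : nat -> seq A,
     (forall e : R, 0 < e -> exists N : nat, forall k l, (N <= k)%N ->
        (N <= l)%N -> semicrossed_norm_le (fsum_sub (a k) (a l)) e) /\
     (forall e : R, 0 < e -> exists N : nat, forall k, (N <= k)%N ->
        forall f, `|lt_fsum (a k) f - T f| <= e%:C * `|f|)].
End SemicrossedProduct.
End Operators.

(* Main.v *)
(* Fourier coefficients with respect to the gauge action reduce the theorem to
   two facts. Write (T_mn) for the matrix of T in Ref, and a_m = T_m0.

   Structure of Ref. If us is the adjoint of a contraction u and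
   us sigma(alpha x) = sigma(x) us, then for 0 < t < 1 the vectors
   xi (x) e_(n+1) - t us xi (x) e_n are orthogonal to all the geometric vectors
   (t^i u^i eta)_i, and the algebra maps them to vectors of the same kind; hence
   T maps them to vectors orthogonal to the geometric vectors. Comparing
   coefficients of powers of t gives T_(0,n+1) = 0 and
   us^(i+1) T_(i+1,n+1) = us^i T_(i,n) us. For u = w this says that T is lower
   triangular with T_(i+1,n+1) = w T_(i,n) w^*. For u = w b^* with b injective in
   the commutant of sigma(C) it says that b commutes with a_m, so a_m belongs to the
   bicommutant of sigma(C): no spectral theorem is needed.

   Approximation. The Fejer means of such a T are bounded by the norm of T,
   because (N - m)_+ counts the windows of length N that contain i and i - m, and
   so they converge strongly to T. Their coefficients are approximated by
   elements of sigma(C) with von Neumann's density argument in an amplification. *)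
Require Import Defs.
From HB Require Import structures.
From mathcomp Require Import all_boot all_order all_algebra.
From mathcomp Require Import complex.
From mathcomp Require Import boolp classical_sets functions reals topology normedtype sequences.
From mathcomp Require Import ring lra.
Set Implicit Arguments.
Unset Strict Implicit.
Unset Printing Implicit Defensive.
Import Order.TTheory GRing.Theory Num.Theory.
Import numFieldNormedType.Exports.
Local Open Scope classical_set_scope.
Local Open Scope ring_scope.
Local Open Scope complex_scope.

(** * Linear maps, norms and inner products *)

Section LinearMaps.
Variables (R : realType) (H K : normedModType R[i]) (T : H -> K).
Hypothesis linT : linear T.

Lemma lin0 : T 0 = 0.
Proof. by have := linT (-1) 0 0; rewrite scaler0 addr0 scaleN1r addNr. Qed.

Lemma linD x y : T (x + y) = T x + T y.
Proof. by have := linT 1 x y; rewrite !scale1r. Qed.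

Lemma linZ a x : T (a *: x) = a *: T x.
Proof. by have := linT a x 0; rewrite lin0 !addr0. Qed.

Lemma linN x : T (- x) = - T x.
Proof. by rewrite -scaleN1r linZ scaleN1r. Qed.

Lemma linB x y : T (x - y) = T x - T y.
Proof. by rewrite linD linN. Qed.

Lemma lin_sum (I : Type) (r : seq I) (P : pred I) (f : I -> H) :
  T (\sum_(i <- r | P i) f i) = \sum_(i <- r | P i) T (f i).
Proof. exact: (big_morph T linD lin0). Qed.
End LinearMaps.

Lemma linear_comp (R : realType) (H K L : normedModType R[i]) (S : K -> L) (T : H -> K) :
  linear S -> linear T -> linear (S \o T).
Proof. by move=> lS lT a x y /=; rewrite lT lS. Qed.

Section RnormExtra.
Variables (R : realType) (V : normedModType R[i]).
Implicit Types x y : V.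

Lemma rnormZr (t : R) x : rnorm (t%:C *: x) = `|t| * rnorm x.
Proof. by rewrite rnormZ normc_def /= expr0n addr0 sqrtr_sqr. Qed.

Lemma rnorm_sum (I : Type) (r : seq I) (P : pred I) (f : I -> V) :
  rnorm (\sum_(i <- r | P i) f i) <= \sum_(i <- r | P i) rnorm (f i).
Proof.
elim/big_ind2: _ => [|x a y b xa yb|//]; first by rewrite rnorm0.
by rewrite (le_trans (rnormD _ _))// lerD.
Qed.

Lemma rnormBC x y : rnorm (x - y) = rnorm (y - x).
Proof. by rewrite -rnormN opprB. Qed.

Lemma rnorm_tri z x y : rnorm (x - y) <= rnorm (x - z) + rnorm (z - y).
Proof. by rewrite -[x - y](subrKA z) rnormD. Qed.

Lemma rnorm_small_eq0 x : (forall e : R, 0 < e -> rnorm x < e) -> x = 0.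
Proof.
move=> h; apply: rnorm0_eq0; apply/eqP; rewrite eq_le rnorm_ge0 andbT.
by rewrite leNgt; apply/negP => /h; rewrite ltxx.
Qed.

Lemma closureP_rnorm (S : set V) x :
  closure S x <-> forall e : R, 0 < e -> exists2 y, S y & rnorm (x - y) < e.
Proof.
split=> [Sx e e0|h B].
  have [|y [Sy]] := Sx (ball x e%:C); first by apply: nbhsx_ballx; rewrite ltcR.
  by rewrite -ball_normE /= rnormE ltcR => xy; exists y.
rewrite -nbhs_ballE => -[[e i]] /=; rewrite ltcE /= => /andP[/eqP -> e0] xB.
have [y Sy xy] := h _ e0; exists y; split => //; apply: xB.
by rewrite -ball_normE /= rnormE ltcR.
Qed.
End RnormExtra.

Section DotExtra.
Variables (R : realType) (H : hilbertType R).
Implicit Types x y : H.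
Local Notation hd := (@hdot R H).

Lemma hdot0r z : hd z 0 = 0.
Proof. by rewrite hdotC hdot0l rmorph0. Qed.
Lemma hdotNl x z : hd (- x) z = - hd x z.
Proof. by rewrite -scaleN1r hdotZl mulN1r. Qed.
Lemma hdotBl x y z : hd (x - y) z = hd x z - hd y z.
Proof. by rewrite hdotDl hdotNl. Qed.
Lemma hdotNr z x : hd z (- x) = - hd z x.
Proof. by rewrite hdotC hdotNl rmorphN /= -hdotC. Qed.
Lemma hdotZrr z (t : R) x : hd z (t%:C *: x) = t%:C * hd z x.
Proof.
rewrite hdotZr; congr (_ * _).
by apply/eqP; rewrite eq_complex /= oppr0 !eqxx.
Qed.

Lemma hdot_suml (I : Type) (r : seq I) (P : pred I) (f : I -> H) z :
  hd (\sum_(i <- r | P i) f i) z = \sum_(i <- r | P i) hd (f i) z.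
Proof. by apply: (big_morph (fun x => hd x z)) => [x y|]; rewrite ?hdotDl ?hdot0l. Qed.

Lemma sqr_rnorm x : rnorm x ^+ 2 = complex.Re (hd x x).
Proof. by rewrite hdot_norm rnormE -rmorphXn. Qed.

(** Polarisation turns the triangle inequality for [x + z] into the upper bound; the lower bound is
    the upper bound at [- y]. *)
Lemma Re_hdot_le x y : `|complex.Re (hd x y)| <= rnorm x * rnorm y.
Proof.
have le z : complex.Re (hd x z) <= rnorm x * rnorm z.
  rewrite Re_hdot; have h := rnormD x z; have h0 := rnorm_ge0 (x + z).
  have : rnorm (x + z) ^+ 2 <= (rnorm x + rnorm z) ^+ 2.
    by rewrite ler_sqr ?nnegrE ?(le_trans h0 h).
  by nra.
rewrite ler_norml le andbT.
have := le (- y); rewrite hdotNr rnormN; case: (hd x y) => a b /=; lra.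
Qed.

(** The bound on real parts is applied to [z^* *: x] with [z = hd x y], whose inner product with [y]
    is [|z|^2]. *)
Lemma hdot_norm_le x y : `|hd x y| <= (rnorm x * rnorm y)%:C.
Proof.
set z := hd x y; have [z0|z0] := eqVneq z 0.
  by rewrite z0 normr0 ler0c mulr_ge0 ?rnorm_ge0.
set r := complex.Re `|z|.
have zE : `|z| = r%:C by rewrite /r normc_def.
have r0 : 0 < r by rewrite -ltcR -zE normr_gt0.
rewrite zE lecR -(ler_pM2l r0) -expr2.
have -> : r ^+ 2 = complex.Re (hd (z^* *: x) y).
  by rewrite hdotZl mulrC -normCK zE -rmorphXn.
rewrite (le_trans (ler_norm _))// (le_trans (Re_hdot_le _ _))//.
by rewrite rnormZ norm_conjC mulrA.
Qed.

Lemma Re_hdot_inj x y : (forall z, complex.Re (hd x z) = complex.Re (hd y z)) -> x = y.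
Proof.
move=> h; apply/eqP; rewrite -subr_eq0; apply/eqP/rnorm0_eq0/eqP.
rewrite -sqrf_eq0 sqr_rnorm hdotBl; have := h (x - y).
by case: (hd x _) => a b; case: (hd y _) => c d /= ->; rewrite subrr.
Qed.

Lemma Re_hdot0_eq0 x y : (forall a, complex.Re (hd x (a *: y)) = 0) -> hd x y = 0.
Proof.
move=> h; apply/eqP; rewrite eq_complex /= Im_hdot h -[y in hd x y]scale1r h.
by rewrite eqxx.
Qed.

Lemma pythagoras x y : hd x y = 0 -> rnorm (x + y) ^+ 2 = rnorm x ^+ 2 + rnorm y ^+ 2.
Proof.
move=> xy; have := Re_hdot x y; rewrite xy /=; lra.
Qed.

Lemma parallelogram x y :
  rnorm (x + y) ^+ 2 + rnorm (x - y) ^+ 2 = 2 * rnorm x ^+ 2 + 2 * rnorm y ^+ 2.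
Proof.
have := Re_hdot x y; have := Re_hdot x (- y); rewrite hdotNr rnormN.
by case: (hd x y) => a b /=; lra.
Qed.

Lemma unitary_rnorm (w ws : H -> H) x : unitary_op w ws -> rnorm (w x) = rnorm x.
Proof.
case=> _ _ adj wK _; apply/eqP; rewrite -(@eqrXn2 _ 2) ?rnorm_ge0//.
by rewrite !sqr_rnorm adj wK.
Qed.

Lemma unitary_sym (w ws : H -> H) : unitary_op w ws -> unitary_op ws w.
Proof.
by case=> bw bws adj wK wsK; split=> // xi eta; rewrite hdotC -adj -hdotC.
Qed.
End DotExtra.

(** * Bounded operators with explicit constants *)

Section BoundedOperators.
Variables (R : realType).

(** The constant is explicit because testing strong convergence on a total set needs one bound for a
    whole sequence of operators. *)
Definition bounded_by (H K : hilbertType R) (C : R) (T : H -> K) : Prop :=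
  linear T /\ forall x, rnorm (T x) <= C * rnorm x.

Lemma bounded_op_by (H K : hilbertType R) (T : H -> K) :
  bounded_op T -> exists2 C, 0 <= C & bounded_by C T.
Proof.
move=> [lT cT].
pose TL := GRing.isLinear.Build R[i] H K *:%R T lT.
pose T' : {linear H -> K} := HB.pack T TL.
have : bounded_near T' (nbhs 0) by apply/linear_bounded_continuous.
move=> /linear_boundedP[M [Mr hM]].
(* [M] is a real element of [R[i]] and every constant strictly above it is a bound, whence [a + 1];
   the maximum makes the constant nonnegative. *)
have [r0 r00 Mr0] : exists2 r : R, 0 <= r & M < r%:C.
  case: M Mr {hM} => a b; rewrite complex_real /= => /eqP ->.
  exists (Num.max 0 (a + 1)); first by rewrite le_max lexx.
  by rewrite ltcR lt_max ltrDl ltr01 orbT.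
exists r0 => //; split => // x.
by have := hM _ Mr0 x; rewrite !rnormE -rmorphM lecR.
Qed.

Lemma bounded_by_op (H K : hilbertType R) (C : R) (T : H -> K) :
  bounded_by C T -> bounded_op T.
Proof.
move=> [lT bT]; split => // x; apply/cvgrPdist_lt => -[e i].
rewrite ltcE /= => /andP[/eqP -> e0].
(* Adding 1 keeps the divisor positive when the bound is 0; the same device recurs below. *)
have C0 : 0 < `|C| + 1 by rewrite ltr_wpDl.
apply/nbhs_ballP; exists (e / (`|C| + 1))%:C; first by rewrite /= ltcR divr_gt0.
move=> y; rewrite -ball_normE /= !rnormE !ltcR ltr_pdivlMr// => xy.
rewrite -(linB lT) (le_lt_trans (bT _))// (le_lt_trans _ xy)// mulrC.
rewrite ler_wpM2l ?rnorm_ge0// (le_trans (ler_norm _))// lerDl//.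
Qed.

End BoundedOperators.

Lemma ler_eps (R : realType) (x y : R) : (forall e : R, 0 < e -> x <= y + e) -> x <= y.
Proof. by move=> h; apply/ler_addgt0Pr => e; exact: h. Qed.

(** * Finitely supported sequences in ell2 *)

Section Ell2Extra.
Variables (R : realType) (H : hilbertType R).
Implicit Types (f g : ell2 H) (x y : H).

Lemma ell2_ext f g : (forall n, f n = g n) -> f = g.
Proof. by move=> h; apply: val_inj; apply/funext. Qed.

Lemma ell2_coordP (n : nat) : linear (fun f : ell2 H => f n).
Proof. by []. Qed.

Lemma ell2_coordDZ a f g n : ell2_seq (a *: f + g) n = a *: f n + g n.
Proof. by []. Qed.

Lemma ell2_coordB f g n : ell2_seq (f - g) n = f n - g n.
Proof. by []. Qed.

Lemma ell2_coordZ a f n : ell2_seq (a *: f) n = a *: f n.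
Proof. by []. Qed.

Lemma ell2_coord_sum (I : Type) (r : seq I) (P : pred I) (F : I -> ell2 H) n :
  ell2_seq (\sum_(i <- r | P i) F i) n = \sum_(i <- r | P i) F i n.
Proof. exact: (lin_sum (ell2_coordP n)). Qed.

Lemma ell2_rnorm_sqr_le f (M : R) :
  (forall N, \sum_(0 <= k < N) rnorm (f k) ^+ 2 <= M) -> rnorm f ^+ 2 <= M.
Proof.
by move=> h; rewrite ell2_rnormE sqr_sqrtr ?nsq_ge0 ?nsq_le//; exact: ell2_summable.
Qed.

Lemma ell2_rnorm_fin f (n : nat) : (forall k, (n <= k)%N -> f k = 0) ->
  rnorm f ^+ 2 <= \sum_(0 <= k < n) rnorm (f k) ^+ 2.
Proof.
move=> h; apply: ell2_rnorm_sqr_le => N.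
have [nN|Nn] := leqP n N.
  rewrite (big_cat_nat (n := n))//= [X in _ + X]big_nat [X in _ + X]big1 ?addr0//.
  by move=> k /andP[nk _]; rewrite h// rnorm0 expr0n.
rewrite [leRHS](big_cat_nat (n := N)) ?(ltnW Nn)//= lerDl sumr_ge0// => k _.
by rewrite sqr_ge0.
Qed.

Lemma basis_tensor_linear n : linear (fun x => basis_tensor x n).
Proof.
move=> a x y; apply: ell2_ext => m.
by rewrite -[RHS]/(a *: basis_tensor x n m + basis_tensor y n m) !basis_tensorE;
   case: eqP => // _; rewrite scaler0 addr0.
Qed.

Lemma rnorm_basis_tensor x n : rnorm (basis_tensor x n) = rnorm x.
Proof.
apply/eqP; rewrite eq_le; apply/andP; split; last first.
  by have := ell2_coord_le (basis_tensor x n) n; rewrite basis_tensorE eqxx.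
rewrite -ler_sqr ?nnegrE ?rnorm_ge0//.
rewrite (le_trans (@ell2_rnorm_fin _ n.+1 _))//.
  by move=> k nk; rewrite basis_tensorE gtn_eqF.
rewrite big_nat_recr//= basis_tensorE eqxx big_nat big1 ?add0r// => k /andP[_ kn].
by rewrite basis_tensorE ltn_eqF// rnorm0 expr0n.
Qed.

Lemma limn_series_single (u : nat -> R) n : (forall m, m != n -> u m = 0) ->
  limn (series u) = u n.
Proof.
move=> h; apply/cvg_lim => //; apply/cvgrPdist_lt => e e0.
exists n.+1 => // N /= nN; rewrite /series /= (big_cat_nat (n := n.+1))//=.
have -> : \sum_(n.+1 <= k < N) u k = 0.
  by rewrite big_nat big1// => k /andP[nk _]; rewrite h// gtn_eqF.
rewrite addr0 big_nat_recr//= big_nat big1 ?add0r ?subrr ?normr0// => k /andP[_ kn].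
by rewrite h// ltn_eqF.
Qed.

Lemma hdot_basis_tensor x n g : hdot (basis_tensor x n) g = hdot x (g n).
Proof.
rewrite -[LHS]/(csum (fun m => hdot (basis_tensor x n m) (g m))) /csum.
rewrite !(@limn_series_single _ n) ?basis_tensorE ?eqxx; first by case: hdot.
  by move=> m mn; rewrite basis_tensorE (negPf mn) hdot0l.
by move=> m mn; rewrite basis_tensorE (negPf mn) hdot0l.
Qed.

Lemma hdot_basis_tensorr f x n : hdot f (basis_tensor x n) = hdot (f n) x.
Proof. by rewrite hdotC hdot_basis_tensor -hdotC. Qed.

Lemma sum_basis_tensorE N (x : 'I_N -> H) (j : 'I_N) :
  ell2_seq (\sum_(i < N) basis_tensor (x i) i) j = x j.
Proof.
rewrite ell2_coord_sum (bigD1 j)//= basis_tensorE eqxx big1 ?addr0// => i ij.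
by rewrite basis_tensorE ifN// eq_sym.
Qed.

Definition ell2_trunc N f : ell2 H := \sum_(n < N) basis_tensor (f n) n.

Lemma ell2_truncE N f k : ell2_trunc N f k = if (k < N)%N then f k else 0.
Proof.
case: ltnP => kN; first exact: (sum_basis_tensorE (fun n : 'I_N => f n) (Ordinal kN)).
by rewrite ell2_coord_sum big1// => i _; rewrite basis_tensorE gtn_eqF// (leq_trans _ kN).
Qed.

Lemma ell2_trunc_cvg f (e : R) : 0 < e ->
  exists N, forall n, (N <= n)%N -> rnorm (f - ell2_trunc n f) < e.
Proof.
move=> e0.
have cv : series (fun n => rnorm (f n) ^+ 2) @ \oo --> nsq f by exact: (@ell2_summable R H f).
have e20 : 0 < e ^+ 2 by rewrite exprn_gt0.
have /cvgrPdist_lt /(_ _ e20) [N _ hN] := cv.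
exists N => n Nn; rewrite -ltr_sqr ?nnegrE ?rnorm_ge0 ?(ltW e0)//.
have := hN n Nn; apply: le_lt_trans.
have [h hE ->] : exists2 h : ell2 H, (forall k, h k = if (k < n)%N then 0 else f k) &
    f - ell2_trunc n f = h.
  exists (f - ell2_trunc n f) => // k.
  by rewrite ell2_coordB ell2_truncE; case: ifP; rewrite ?subrr ?subr0.
rewrite (le_trans _ (ler_norm _))//; apply: ell2_rnorm_sqr_le => M.
rewrite lerBrDl; have [Mn|nM] := leqP M n.
  rewrite [X in _ + X]big_nat big1 ?addr0 => [|k /andP[_ kM]].
    exact: (nsq_ge n (@ell2_summable R H f)).
  by rewrite hE (leq_trans kM Mn) rnorm0 expr0n.
have := nsq_ge M (@ell2_summable R H f); apply: le_trans.
rewrite [leRHS](big_cat_nat (n := n)) ?(ltnW nM)//= lerD2l.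
rewrite (big_cat_nat (n := n)) ?(ltnW nM)//= big_nat big1 ?add0r.
  rewrite big_nat [leRHS]big_nat ler_sum// => k /andP[nk _].
  by rewrite hE ltnNge nk.
by move=> k /andP[_ kn]; rewrite hE kn rnorm0 expr0n.
Qed.

(* Convergence to 0 is tested on the total set of elementary tensors. *)
Lemma strong_cvg0_ell2 (K : hilbertType R) (C : R) (G : nat -> ell2 H -> K) :
  0 <= C -> (forall N, bounded_by C (G N)) ->
  (forall x n (e : R), 0 < e -> exists N0, forall N, (N0 <= N)%N ->
     rnorm (G N (basis_tensor x n)) < e) ->
  forall f (e : R), 0 < e -> exists N0, forall N, (N0 <= N)%N -> rnorm (G N f) < e.
Proof.
move=> C0 bG h f e e0.
have e20 : 0 < e / 2 by rewrite divr_gt0.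
have eC0 : 0 < e / 2 / (C + 1) by rewrite divr_gt0// ltr_wpDl.
have [M /(_ M (leqnn _)) hM] := ell2_trunc_cvg f eC0.
have [N0 hN0] : exists N0, forall N, (N0 <= N)%N -> rnorm (G N (ell2_trunc M f)) < e / 2.
  rewrite /ell2_trunc; elim: M (e / 2) e20 {hM eC0} => [|M IH] d d0.
    by exists 0%N => N _; rewrite big_ord0 (lin0 (bG N).1) rnorm0.
  have d20 : 0 < d / 2 by rewrite divr_gt0.
  have [N1 h1] := IH _ d20; have [N2 h2] := h (f M) M _ d20.
  exists (maxn N1 N2) => N; rewrite geq_max => /andP[n1 n2].
  rewrite big_ord_recr /= (linD (bG N).1) (le_lt_trans (rnormD _ _))//.
  by rewrite [ltRHS](splitr d) ltrD// ?h1 ?h2.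
exists N0 => N NN; rewrite -[f](subrK (ell2_trunc M f)) (linD (bG N).1).
rewrite (le_lt_trans (rnormD _ _))// [ltRHS](splitr e) ler_ltD ?hN0//.
rewrite (le_trans ((bG N).2 _))//.
move: hM; rewrite ltr_pdivlMr ?ltr_wpDl// => hM.
have := rnorm_ge0 (f - ell2_trunc M f).
move: hM; move: (rnorm _) => r; nra.
Qed.
End Ell2Extra.

Section DiagOp.
Variables (R : realType) (H : hilbertType R) (C : R) (A : nat -> H -> H).
Hypothesis C0 : 0 <= C.
Hypothesis bA : forall n, bounded_by C (A n).

Lemma diag_op_coord f n : diag_op A f n = A n (f n).
Proof. by apply: (@diag_opE _ _ _ C) => k x; exact: (bA k).2. Qed.

Lemma diag_op_bounded : bounded_by C (diag_op A).
Proof.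
split=> [a f g|f].
  apply: ell2_ext => n.
  rewrite diag_op_coord -[RHS]/(a *: diag_op A f n + diag_op A g n) !diag_op_coord.
  exact: (bA n).1.
apply: ell2_rnorm_le; first by rewrite mulr_ge0 ?rnorm_ge0.
move=> N; rewrite exprMn (le_trans _ (ler_wpM2l (sqr_ge0 _) (ell2_sum_le f N)))//.
rewrite mulr_sumr ler_sum// => k _; rewrite diag_op_coord -exprMn.
by rewrite ler_sqr ?nnegrE ?rnorm_ge0 ?mulr_ge0 ?rnorm_ge0//; exact: (bA k).2.
Qed.

Lemma diag_op_tensor x n : diag_op A (basis_tensor x n) = basis_tensor (A n x) n.
Proof. by rewrite diag_op_basis// => k; exact: lin0 (bA k).1. Qed.
End DiagOp.

(** * Orthogonal projections *)

Section Projection.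
Variables (R : realType) (H : hilbertType R) (S : set H).
Hypothesis S0 : S 0.
Hypothesis SP : forall a x y, S x -> S y -> S (a *: x + y).
Local Notation hd := (@hdot R H).
Implicit Types x y z s : H.

Lemma closure_submod a x y : closure S x -> closure S y -> closure S (a *: x + y).
Proof.
move=> /closureP_rnorm hx /closureP_rnorm hy; apply/closureP_rnorm => e e0.
set c := complex.Re `|a|.
have c0 : 0 <= c by rewrite /c normc_def /= sqrtr_ge0.
have e1 : 0 < e / 2 / (c + 1) by rewrite !divr_gt0// ltr_wpDl.
have e20 : 0 < e / 2 by rewrite divr_gt0.
have [s Ss xs] := hx _ e1; have [t St yt] := hy _ e20.
exists (a *: s + t); first exact: SP.
rewrite opprD addrACA -scalerBr (le_lt_trans (rnormD _ _))// rnormZ -/c.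
rewrite [ltRHS](splitr e) ler_ltD//.
move: xs; rewrite ltr_pdivlMr ?ltr_wpDl//; have := rnorm_ge0 (x - s); nra.
Qed.

(** The orthogonal projection onto the closure of [S], characterised by orthogonality to [S] alone;
    continuity of the inner product extends it to the closure. *)
Definition is_proj x y := closure S y /\ forall s, S s -> hd (x - y) s = 0.

Lemma is_proj_orth x y s : is_proj x y -> closure S s -> hd (x - y) s = 0.
Proof.
move=> [_ xy] /closureP_rnorm hs.
apply: Re_hdot0_eq0 => a; apply/eqP; rewrite -normr_eq0; apply/eqP/le_anti.
rewrite normr_ge0 andbT; apply: ler_eps => e e0; rewrite add0r.
set c := complex.Re `|a| * rnorm (x - y).
have c0 : 0 <= c by rewrite mulr_ge0 ?rnorm_ge0// normc_def /= sqrtr_ge0.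
have e1 : 0 < e / (c + 1) by rewrite divr_gt0// ltr_wpDl.
have [t St st] := hs _ e1.
rewrite -[s](subrK t) scalerDr hdotDr (hdotZr _ a t) (xy _ St) mulr0 addr0.
rewrite (le_trans (Re_hdot_le _ _))// rnormZ mulrCA mulrA -/c.
move: st; rewrite ltr_pdivlMr ?ltr_wpDl//; have := rnorm_ge0 (s - t); nra.
Qed.

Lemma is_proj_unique x y z : is_proj x y -> is_proj x z -> y = z.
Proof.
move=> xy xz; apply/eqP; rewrite -subr_eq0; apply/eqP/rnorm0_eq0/eqP.
have yz : closure S (y - z).
  by rewrite addrC -scaleN1r; apply: closure_submod; [exact: xz.1|exact: xy.1].
have h : hd (y - z) (y - z) = 0.
  rewrite [X in hd X _ = _](_ : _ = (x - z) - (x - y)).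
    by rewrite hdotBl !is_proj_orth// subrr.
  by rewrite opprB [RHS]addrC addrA subrK.
by rewrite -sqrf_eq0 sqr_rnorm h.
Qed.

(** A minimising sequence for the distance to [S] is Cauchy by the parallelogram law, and the first
    variation at its limit gives orthogonality. *)
Lemma proj_exists x : exists y, is_proj x y.
Proof.
pose D := [set rnorm (x - s) | s in S].
have D0 : has_inf D.
  split; first by exists (rnorm (x - 0)), 0.
  by exists 0 => _ [s _ <-]; exact: rnorm_ge0.
pose d := inf D.
have d0 : 0 <= d by apply: lb_le_inf; [exact: D0.1|move=> _ [s _ <-]; exact: rnorm_ge0].
have dS s : S s -> d <= rnorm (x - s) by move=> Ss; apply: ge_inf; [exact: D0.2|exists s].
have near n : exists s, S s /\ rnorm (x - s) ^+ 2 < d ^+ 2 + n.+1%:R^-1.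
  have n0 : (0 : R) < n.+1%:R^-1 by rewrite invr_gt0 ltr0n.
  (* Since [e <= 1], the gap [(d + e)^2 - d^2] is at most [e (2 d + 1)], hence at most
     [1 / (n + 1)]. *)
  pose e : R := Num.min 1 (n.+1%:R^-1 / (2 * d + 1)).
  have D1 : 0 < 2 * d + 1 by rewrite ltr_wpDl// mulr_ge0.
  have e0 : 0 < e by rewrite lt_min ltr01 divr_gt0.
  have [_ [s Ss <-] hs] := inf_adherent e0 D0.
  exists s; split => //; rewrite -/d in hs.
  have e1 : e <= 1 by rewrite ge_min lexx.
  have e2 : e * (2 * d + 1) <= n.+1%:R^-1.
    by rewrite -ler_pdivlMr// ge_min lexx orbT.
  have : rnorm (x - s) ^+ 2 < (d + e) ^+ 2.
    by rewrite ltr_sqr ?nnegrE ?rnorm_ge0 ?addr_ge0 ?(ltW e0).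
  have : e * e <= e by rewrite ger_pMl.
  move: e2; rewrite sqrrD; move: (n.+1%:R^-1) => a; lra.
have [u hu] := choice near.
have cau n m : rnorm (u n - u m) ^+ 2 <= 2 * n.+1%:R^-1 + 2 * m.+1%:R^-1.
  have := parallelogram (x - u m) (x - u n).
  have -> : x - u m - (x - u n) = u n - u m.
    by rewrite opprB [LHS]addrC subrKA.
  have -> : x - u m + (x - u n) = 2%:C *: (x - 2^-1%:C *: (u m + u n)).
    rewrite scalerBr scalerA (_ : 2%:C * 2^-1%:C = 1); last first.
      by rewrite -rmorphM mulfV ?rmorph1 ?pnatr_eq0.
    rewrite scale1r (_ : 2%:C = 1 + 1); last by apply/eqP; rewrite eq_complex /= addr0 !eqxx.
    by rewrite scalerDl scale1r opprD addrACA.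
  rewrite rnormZr exprMn => h.
  have : d <= rnorm (x - 2^-1%:C *: (u m + u n)).
    apply: dS; rewrite -[_ *: _]addr0; apply: SP => //.
    by rewrite -[u m]scale1r; apply: SP; [exact: (hu m).1|exact: (hu n).1].
  have := (hu m).2; have := (hu n).2.
  move: h; rewrite ger0_norm//; set p := rnorm (x - _ *: _).
  move: (n.+1%:R^-1) (m.+1%:R^-1) => a b; nra.
have small (e : R) : 0 < e -> exists N, forall n, (N <= n)%N -> n.+1%:R^-1 < e.
  move=> e0; exists (Num.truncn e^-1).+1 => n Nn.
  rewrite invf_plt ?posrE ?ltr0n// (lt_le_trans (truncnS_gt _))// ler_nat.
  exact: (leq_trans Nn).
have cu : cauchy (u @ \oo).
  apply/cauchyP => -[e i]; rewrite ltcE /= => /andP[/eqP -> e0].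
  have e20 : 0 < e ^+ 2 / 4 by rewrite divr_gt0// exprn_gt0.
  have [N hN] := small _ e20; exists (u N), N => // n /= Nn.
  rewrite -ball_normE /= rnormE ltcR -ltr_sqr ?nnegrE ?rnorm_ge0 ?ltW//.
  apply: le_lt_trans (cau N n) _.
  have := hN N (leqnn _); have := hN n Nn.
  move: (N.+1%:R^-1) (n.+1%:R^-1) => a b; lra.
have [y uy] : exists y : H, u @ \oo --> y by apply/cvg_ex; exact: (@cauchy_cvg H (u @ \oo) _ cu).
have uyd (e : R) : 0 < e -> exists N, forall n, (N <= n)%N -> rnorm (y - u n) < e.
  move=> e0; move/cvgrPdist_lt : uy => /(_ e%:C); rewrite ltcR => /(_ e0)[N _ hN].
  by exists N => n /hN /=; rewrite rnormE ltcR.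
have Sy : closure S y.
  apply/closureP_rnorm => e /uyd[N /(_ N (leqnn _))]; exists (u N) => //.
  exact: (hu N).1.
have xy : rnorm (x - y) <= d.
  apply: ler_eps => e e0.
  have e20 : 0 < e / 2 by rewrite divr_gt0.
  have [N hN] := uyd _ e20.
  have [M hM] : exists M, forall n, (M <= n)%N -> rnorm (x - u n) < d + e / 2.
    have e40 : 0 < (e / 2) ^+ 2 by rewrite exprn_gt0.
    have [M hM] := small _ e40; exists M => n /hM h.
    rewrite -ltr_sqr ?nnegrE ?rnorm_ge0 ?addr_ge0 ?(ltW e20)//.
    apply: (lt_le_trans (hu n).2).
    by rewrite sqrrD; move: h; move: (n.+1%:R^-1) => a; nra.
  apply: (le_trans (rnorm_tri (u (maxn N M)) _ _)).
  have := hM (maxn N M) (leq_maxr _ _).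
  have := hN (maxn N M) (leq_maxl _ _).
  rewrite (rnormBC y); lra.
have dcl s : closure S s -> d <= rnorm (x - s).
  move=> /closureP_rnorm hs; apply: ler_eps => e /hs[t St st].
  apply: (le_trans (dS _ St)); apply: (le_trans (rnorm_tri s _ _)).
  by rewrite lerD2l ltW.
exists y; split => // s Ss; apply: Re_hdot0_eq0 => a.
set s' := a *: s.
have Ss' : S s' by rewrite -[s']addr0; exact: SP.
have key (t : R) : 0 <= t ^+ 2 * rnorm s' ^+ 2 - 2 * t * complex.Re (hd (x - y) s').
  have := dcl (t%:C *: s' + y) (@closure_submod t%:C s' y (subset_closure Ss') Sy).
  rewrite opprD addrCA => h.
  have := Re_hdot (x - y) (- (t%:C *: s')).
  rewrite hdotNr hdotZrr rnormN rnormZr exprMn real_normK ?num_real//.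
  rewrite [in rnorm (x - y + _)]addrC.
  have : rnorm (x - y) ^+ 2 <= rnorm (- (t%:C *: s') + (x - y)) ^+ 2.
    by rewrite ler_sqr ?nnegrE ?rnorm_ge0// (le_trans xy).
  move: (rnorm (- _ + _) ^+ 2) => A; case: (hd (x - y) s') => p q /=.
  lra.
set r := complex.Re _ in key *.
set b := rnorm s' ^+ 2 in key.
have b0 : 0 <= b by rewrite sqr_ge0.
(* At this [t] the quadratic equals [- r^2 (b + 2) / (b + 1)^2], which forces [r = 0]; the divisor
   [b + 1] covers [s' = 0] too. *)
have := key (r / (b + 1)).
have b1 : 0 < b + 1 by rewrite ltr_wpDl.
have -> : (r / (b + 1)) ^+ 2 * b - 2 * (r / (b + 1)) * r
    = - (r ^+ 2 * ((b + 2) / (b + 1) ^+ 2)).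
  by field; rewrite gt_eqF.
rewrite oppr_ge0 pmulr_lle0 ?divr_gt0 ?exprn_gt0// ?ltr_wpDl//.
by move=> h; apply/eqP; rewrite -sqrf_eq0 eq_le h sqr_ge0.
Qed.

Definition proj x : H := xget 0 (is_proj x).

Lemma projP x : is_proj x (proj x).
Proof. by rewrite /proj; case: xgetP => // h; have [y /h] := proj_exists x. Qed.

Lemma proj_id x : closure S x -> proj x = x.
Proof.
move=> Sx; apply: is_proj_unique (projP x) _; split => // s _.
by rewrite subrr hdot0l.
Qed.

Lemma proj_linear : linear proj.
Proof.
move=> a x y; apply: is_proj_unique (projP _) _.
split; first by apply: closure_submod; exact: (projP _).1.
move=> s Ss; rewrite opprD addrACA -scalerBr hdotPl !(projP _).2// mulr0 addr0//.
Qed.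

Lemma proj_adj x y : hd (proj x) y = hd x (proj y).
Proof.
have orth u v : hd (proj u) (v - proj v) = 0.
  by rewrite hdotC (is_proj_orth (projP v) (projP u).1) rmorph0.
rewrite -[y in LHS](subrK (proj y)) hdotDr orth add0r.
by rewrite -[x in RHS](subrK (proj x)) hdotDl (is_proj_orth (projP x) (projP y).1) add0r.
Qed.

Lemma proj_contract x : rnorm (proj x) <= rnorm x.
Proof.
rewrite -ler_sqr ?nnegrE ?rnorm_ge0// -[x in leRHS](subrK (proj x)).
rewrite pythagoras ?lerDr ?sqr_ge0//.
exact: is_proj_orth (projP x) (projP x).1.
Qed.

(** [B] maps the closure of [S] into itself, and since [Bs] preserves [S] it maps vectors orthogonal
    to [S] to such vectors; uniqueness of the decomposition does the rest. *)
Lemma proj_commute (C : R) (B Bs : H -> H) : bounded_by C B -> 0 <= C ->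
  (forall x y, hd (B x) y = hd x (Bs y)) ->
  (forall s, S s -> S (B s)) -> (forall s, S s -> S (Bs s)) ->
  forall x, proj (B x) = B (proj x).
Proof.
move=> bB C0 adj SB SBs x; apply: is_proj_unique (projP _) _; split.
  apply/closureP_rnorm => e e0.
  have e1 : 0 < e / (C + 1) by rewrite divr_gt0// ltr_wpDl.
  have /closureP_rnorm/(_ _ e1)[s Ss hs] := (projP x).1.
  exists (B s); first exact: SB.
  rewrite -(linB bB.1) (le_lt_trans (bB.2 _))//.
  move: hs; rewrite ltr_pdivlMr ?ltr_wpDl//; have := rnorm_ge0 (proj x - s); nra.
by move=> s Ss; rewrite -(linB bB.1) adj (projP x).2//; exact: SBs.
Qed.
End Projection.

(** * Amplifications and the bicommutant *)

Section IterUnitary.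
Variables (R : realType) (H : hilbertType R) (w ws : H -> H).
Hypothesis uw : unitary_op w ws.

Lemma unitary_iter n : unitary_op (iter n w) (iter n ws).
Proof.
have iK u v : cancel u v -> cancel (iter n u) (iter n v : H -> H).
  by move=> uK; elim: (n) => [|m IH] x //; rewrite [iter _ u _]iterS [iter _ v _]iterSr uK.
have lin u v : unitary_op u v -> bounded_by 1 (iter n u : H -> H).
  move=> uv; have lu : linear u by case: uv => -[].
  elim: (n) => [|m [lIH bIH]]; first by split => // x; rewrite mul1r.
  split=> [a x y|x]; first by rewrite iterS lIH lu.
  by rewrite iterS (unitary_rnorm _ uv); exact: bIH.
case: (uw) => bw bws adj wK wsK; split; last 2 first.
- exact: iK wK.
- exact: iK wsK.
- exact: bounded_by_op (lin _ _ uw).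
- exact: bounded_by_op (lin _ _ (unitary_sym uw)).
by elim: (n) => // m IH xi eta; rewrite [iter _ w _]iterS [iter _ ws _]iterSr adj IH.
Qed.

Definition conj_iter (A : H -> H) (n : nat) (x : H) : H := iter n w (A (iter n ws x)).

(** The blocks are [w^n A w^-n]. Under the covariance relation this is [sigma_tilde x] for
    [A = sigma x]; for [w = id] it is the plain amplification of [A]. *)
Definition twisted_amp (A : H -> H) : ell2 H -> ell2 H := diag_op (conj_iter A).

Lemma conj_iter_bounded C A n : bounded_by C A -> bounded_by C (conj_iter A n).
Proof.
have un := unitary_iter n.
move=> [lA bA]; split=> [a x y|x]; rewrite /conj_iter.
  case: (un) => -[lw _] [lws _] _ _ _.
  by rewrite lws lA lw.
by rewrite (unitary_rnorm _ un) (le_trans (bA _))// (unitary_rnorm _ (unitary_sym un)).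
Qed.
End IterUnitary.

Section TwistedAmp.
Variables (R : realType) (H : hilbertType R) (w ws : H -> H).
Hypothesis uw : unitary_op w ws.

Section One.
Variables (C : R) (A : H -> H).
Hypotheses (C0 : 0 <= C) (bA : bounded_by C A).

Lemma twisted_ampE f n : twisted_amp w ws A f n = conj_iter w ws A n (f n).
Proof. by apply: (diag_op_coord (C := C)) => k; exact: conj_iter_bounded. Qed.

Lemma twisted_amp_bounded : bounded_by C (twisted_amp w ws A).
Proof. by apply: diag_op_bounded => // k; exact: conj_iter_bounded. Qed.

Lemma twisted_amp_tensor x n :
  twisted_amp w ws A (basis_tensor x n) = basis_tensor (conj_iter w ws A n x) n.
Proof. by apply: (diag_op_tensor (C := C)) => k; exact: conj_iter_bounded. Qed.
End One.

(** Used with [P = sigma cone], to carry the nondegeneracy condition of the density argument through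
    amplifications. *)
Lemma twisted_amp_absorb (D E : R) (B P : H -> H) : bounded_by D B -> bounded_by E P ->
  (forall x, B (P x) = B x) ->
  forall f, twisted_amp w ws B (twisted_amp w ws P f) = twisted_amp w ws B f.
Proof.
move=> bB bP BP f; apply: ell2_ext => n.
rewrite (twisted_ampE bB (twisted_amp _ _ _ _)) (twisted_ampE bP) (twisted_ampE bB) /conj_iter.
by case: (unitary_iter uw n) => _ _ _ -> _; rewrite BP.
Qed.

Lemma eq_on_tensors (K : hilbertType R) (C D : R) (S T : ell2 H -> K) : 0 <= C -> 0 <= D ->
  bounded_by C S -> bounded_by D T ->
  (forall x n, S (basis_tensor x n) = T (basis_tensor x n)) -> forall f, S f = T f.
Proof.
move=> C0 D0 [lS bS] [lT bT] h f; apply/eqP; rewrite -subr_eq0; apply/eqP.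
apply: rnorm_small_eq0 => e e0.
have bG (N : nat) : bounded_by (C + D) (fun f => S f - T f).
  split=> [a x y|x]; first by rewrite lS lT opprD addrACA scalerBr.
  by rewrite (le_trans (rnormD _ _))// rnormN mulrDl lerD.
have [|N /(_ N (leqnn _))] := strong_cvg0_ell2 (addr_ge0 C0 D0) bG _ f e0; last by [].
by move=> x n d d0; exists 0%N => N _; rewrite h subrr rnorm0.
Qed.

Lemma star_rep_twisted (A : cstarType R) (pi : A -> H -> H) :
  star_rep pi -> star_rep (fun x => twisted_amp w ws (pi x)).
Proof.
move=> [bpi lpi mpi spi].
have bd x : exists2 C, 0 <= C & bounded_by C (pi x) by exact: bounded_op_by.
have tE x f n : twisted_amp w ws (pi x) f n = conj_iter w ws (pi x) n (f n).
  by have [C C0 bC] := bd x; exact: twisted_ampE bC _ _.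
split.
- by move=> x; have [C C0 bC] := bd x; exact: bounded_by_op (twisted_amp_bounded C0 bC).
- move=> a x y f; apply: ell2_ext => n.
  rewrite tE -[RHS]/(a *: twisted_amp w ws (pi x) f n + twisted_amp w ws (pi y) f n) !tE.
  by rewrite /conj_iter lpi; case: (unitary_iter uw n) => -[-> _].
- move=> x y f; apply: ell2_ext => n; rewrite !tE /conj_iter mpi.
  by case: (unitary_iter uw n) => _ _ _ ->.
- move=> x f g; congr csum; apply/funext => n; rewrite !tE /conj_iter.
  case: (unitary_iter uw n) => _ _ adj _ _.
  case: (unitary_iter (unitary_sym uw) n) => _ _ adjs _ _.
  by rewrite adj spi adjs.
Qed.

(** Membership in the bicommutant of the family [pi]. Testing contractions suffices by scaling, and
    the adjoint is supplied as data. *)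
Definition bicommutes (I : Type) (K : hilbertType R) (pi : I -> K -> K) (A : K -> K) : Prop :=
  forall c cs : K -> K, bounded_by 1 c -> bounded_by 1 cs ->
    (forall x y, hdot (c x) y = hdot x (cs y)) ->
    (forall i x, c (pi i x) = pi i (c x)) -> forall x, c (A x) = A (c x).

(* The matrix entries of an operator commuting with the amplification,
   twisted back, commute with the original family. *)
Lemma bicommutes_twisted (I : Type) (pi : I -> H -> H) (A : H -> H) :
  (forall i, bounded_op (pi i)) -> bounded_op A ->
  bicommutes pi A ->
  bicommutes (fun i => twisted_amp w ws (pi i)) (twisted_amp w ws A).
Proof.
move=> bpi /bounded_op_by[M M0 bA] biA Q Qs bQ bQs adjQ comQ.
pose E (q : ell2 H -> ell2 H) i j x := iter i ws (q (basis_tensor (iter j w x) j) i).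
have un i := unitary_iter uw i.
have usn i := unitary_iter (unitary_sym uw) i.
have bE q : bounded_by 1 q -> forall i j, bounded_by 1 (E q i j).
  move=> [lq bq] i j; split=> [a x y|x]; rewrite /E.
    case: (un j) => -[-> _] _ _ _ _; case: (usn i) => -[lws _] _ _ _ _.
    by rewrite basis_tensor_linear lq -lws.
  rewrite (unitary_rnorm _ (usn i)) (le_trans (ell2_coord_le _ _))// (le_trans (bq _))//.
  by rewrite rnorm_basis_tensor (unitary_rnorm _ (un j)).
have adjE i j x y : hdot (E Q i j x) y = hdot x (E Qs j i y).
  rewrite /E; case: (usn i) => _ _ -> _ _; rewrite -hdot_basis_tensorr adjQ.
  by rewrite hdot_basis_tensor; case: (un j) => _ _ -> _ _.
have tE B C : 0 <= C -> bounded_by C B ->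
    forall f n, twisted_amp w ws B f n = conj_iter w ws B n (f n).
  by move=> C0 bB f n; exact: twisted_ampE bB _ _.
have comE i j k x : E Q i j (pi k x) = pi k (E Q i j x).
  have [C C0 bC] := bounded_op_by (bpi k).
  have := comQ k (basis_tensor (iter j w x) j).
  rewrite (twisted_amp_tensor bC) /conj_iter => /(congr1 (fun f : ell2 H => iter i ws (f i))).
  rewrite (tE _ _ C0 bC) /conj_iter.
  case: (un i) => _ _ _ -> _; case: (un j) => _ _ _ -> _.
  by [].
have comA i j x := biA _ _ (bE _ bQ i j) (bE _ bQs j i) (adjE i j) (comE i j) x.
have bD := twisted_amp_bounded M0 bA.
have bQD : bounded_by M (Q \o twisted_amp w ws A).
  split; first exact: linear_comp bQ.1 bD.1.
  by move=> f /=; rewrite (le_trans (bQ.2 _))// mul1r; exact: bD.2.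
have bDQ : bounded_by M (twisted_amp w ws A \o Q).
  split; first exact: linear_comp bD.1 bQ.1.
  move=> f /=; rewrite (le_trans (bD.2 _))// ler_wpM2l//.
  by have := bQ.2 f; rewrite mul1r.
apply: (eq_on_tensors M0 M0 bQD bDQ) => x j /=; apply: ell2_ext => i.
rewrite (tE _ _ M0 bA) (twisted_amp_tensor bA) /conj_iter.
have := comA i j (iter j ws x); rewrite /E.
case: (un j) => _ _ _ _ -> /(congr1 (iter i w)).
by case: (un i) => _ _ _ _ ->.
Qed.
End TwistedAmp.

(** Von Neumann's argument: the projection onto the closure of [pi(A) x] commutes with [pi], hence
    with [T]. It fixes [pi cone x], so it fixes [T (pi cone x) = T x]. *)
Lemma bicommutant_density (R : realType) (H : hilbertType R) (A : cstarType R)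
    (pi : A -> H -> H) (T : H -> H) :
  star_rep pi -> bicommutes pi T -> (forall x, T (pi cone x) = T x) ->
  forall x (e : R), 0 < e -> exists a, rnorm (T x - pi a x) < e.
Proof.
move=> [bpi lpi mpi spi] biT T1 x e e0.
pose S := [set pi a x | a in [set: A]].
have S0 : S 0.
  by exists 0 => //; have := lpi (-1) 0 0 x; rewrite scaler0 addr0 scaleN1r addNr.
have SP a y z : S y -> S z -> S (a *: y + z).
  by move=> [b _ <-] [c _ <-]; exists (a *: b + c) => //; rewrite lpi.
have Spi a y : S y -> S (pi a y) by move=> [b _ <-]; exists (cmul a b).
have bP : bounded_by 1 (proj S).
  split; first exact: proj_linear.
  by move=> y; rewrite mul1r; exact: proj_contract.
have comP a y : proj S (pi a y) = pi a (proj S y).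
  have [C C0 bC] := bounded_op_by (bpi a).
  apply: (proj_commute S0 SP bC C0 (Bs := pi (star a))); last 2 first.
  - by move=> s; exact: Spi.
  - by move=> s; exact: Spi.
  - by move=> u v; rewrite -spi starK.
have := biT _ _ bP bP (proj_adj S0 SP) comP (pi cone x).
rewrite T1 [proj S (pi _ _)]proj_id//; last by apply: subset_closure; exists cone.
rewrite T1 => PT.
have [+ _] := projP S0 SP (T x); rewrite PT => /closureP_rnorm/(_ e e0)[_ [a _ <-] h].
by exists a.
Qed.

(** * Fejer means *)

(** Cauchy-Schwarz against the constant sequence: the sum of the squares [(n r_k - S)^2] equals
    [n (n Q - S^2)]. *)
Lemma sqr_sum_le (R : realType) (N : nat) (r : nat -> R) :
  (\sum_(k < N.+1) r k) ^+ 2 <= N.+1%:R * \sum_(k < N.+1) r k ^+ 2.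
Proof.
set S := \sum_(k < N.+1) r k; set Q := \sum_(k < N.+1) _.
set n : R := N.+1%:R.
have n0 : 0 < n by rewrite ltr0n.
have : 0 <= \sum_(k < N.+1) (n * r k - S) ^+ 2 by rewrite sumr_ge0// => k _; rewrite sqr_ge0.
rewrite (eq_bigr (fun k : 'I_N.+1 => n ^+ 2 * r k ^+ 2 - 2 * n * S * r k + S ^+ 2)); last first.
  by move=> k _; ring.
rewrite 2!big_split /= -mulr_sumr sumrN -mulr_sumr sumr_const card_ord -/S -/Q.
rewrite -[S ^+ 2 *+ _]mulr_natl -/n.
have -> : n ^+ 2 * Q - 2 * n * S * S + n * S ^+ 2 = n * (n * Q - S ^+ 2) by ring.
by rewrite pmulr_rge0// subr_ge0.
Qed.

(** * Truncations and windows *)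

Section Windows.
Variables (R : realType) (H : hilbertType R).
Implicit Types f g : ell2 H.

Lemma ell2_rnorm_mono f g : (forall k, rnorm (f k) <= rnorm (g k)) -> rnorm f <= rnorm g.
Proof.
move=> h; apply: ell2_rnorm_le; first exact: rnorm_ge0.
move=> N; rewrite (le_trans _ (ell2_sum_le g N))// ler_sum// => k _.
by rewrite ler_sqr ?nnegrE ?rnorm_ge0.
Qed.

Lemma ell2_trunc_bounded N : bounded_by 1 (@ell2_trunc R H N).
Proof.
split=> [a f g|f]; last first.
  rewrite mul1r; apply: ell2_rnorm_mono => k; rewrite ell2_truncE.
  by case: ifP => // _; rewrite rnorm0 rnorm_ge0.
apply: ell2_ext => k; rewrite -[RHS]/(a *: ell2_trunc N f k + ell2_trunc N g k).
by rewrite !ell2_truncE; case: ifP => // _; rewrite scaler0 addr0.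
Qed.

(** Keeps the coordinates [i] with [k - N < i <= k]; writing the condition with a sum avoids
    truncated subtraction. *)
Definition ell2_window (N k : nat) : ell2 H -> ell2 H :=
  diag_op (fun i x => if (i <= k < i + N)%N then x else 0).

Lemma ell2_windowE N k f i :
  ell2_window N k f i = if (i <= k < i + N)%N then f i else 0.
Proof.
apply: (diag_op_coord (C := 1)) => n; split=> [a x y|x].
  by case: ifP => // _; rewrite scaler0 addr0.
by case: ifP => _; rewrite ?rnorm0 ?mul1r ?rnorm_ge0.
Qed.

Lemma window_count (i N K : nat) (c : R) : 0 <= c ->
  \sum_(0 <= k < K) (if (i <= k < i + N)%N then c else 0) <= N%:R * c.
Proof.
move=> c0; pose F k : R := if (i <= k < i + N)%N then c else 0.
have F0 k : 0 <= F k by rewrite /F; case: ifP.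
(* The enlarged range contains the whole interval from [i] to [i + N - 1], outside which [F]
   vanishes. *)
apply: (@le_trans _ _ (\sum_(0 <= k < i + N + K) F k)).
  by rewrite [leRHS](big_cat_nat (n := K)) ?leq_addl//= lerDl sumr_ge0.
rewrite (big_cat_nat (n := i)) ?(leq_trans (leq_addr N i)) ?leq_addr//=.
rewrite (big_cat_nat (n := i + N) (m := i)) ?leq_addr//=.
have -> : \sum_(0 <= k < i) F k = 0.
  by rewrite big_nat big1// => k /andP[_ ki]; rewrite /F leqNgt ki.
have -> : \sum_(i + N <= k < i + N + K) F k = 0.
  by rewrite big_nat big1// => k /andP[ki _]; rewrite /F ltnNge ki andbF.
rewrite add0r addr0 big_nat (eq_bigr (fun=> c)); last by move=> k; rewrite /F => ->.
by rewrite -big_nat sumr_const_nat addKn mulr_natl.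
Qed.

(** After exchanging the sums, each coordinate is counted at most [N] times. The windows with
    [k < K] see only coordinates below [K]. *)
Lemma sum_window_rnorm N K f :
  \sum_(0 <= k < K) rnorm (ell2_window N k f) ^+ 2 <= N%:R * rnorm f ^+ 2.
Proof.
apply: (@le_trans _ _ (\sum_(0 <= k < K) \sum_(0 <= i < K)
   if (i <= k < i + N)%N then rnorm (f i) ^+ 2 else 0)).
  rewrite big_nat [leRHS]big_nat ler_sum// => k /andP[_ kK].
  rewrite (le_trans (@ell2_rnorm_fin _ _ _ K _))//.
    by move=> i Ki; rewrite ell2_windowE leqNgt (leq_trans kK Ki).
  rewrite ler_sum// => i _; rewrite ell2_windowE.
  by case: ifP => //; rewrite rnorm0 expr0n.
rewrite exchange_big /= (le_trans _ (ler_wpM2l _ (ell2_sum_le f K)))// mulr_sumr ler_sum// => i _.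
by apply: window_count; rewrite sqr_ge0.
Qed.
End Windows.

Lemma iter_ushiftE (R : realType) (H : hilbertType R) (f : ell2 H) m i :
  iter m (@ushift R H) f i = if (m <= i)%N then f (i - m)%N else 0.
Proof.
elim: m i => [|m IH] i; first by rewrite subn0.
by rewrite iterS ushiftE; case: i => [|i]//; rewrite IH.
Qed.

(** * Fejer means of twisted Toeplitz operators *)

Section Fejer.
Variables (R : realType) (H : hilbertType R) (w ws : H -> H) (C : R) (T : ell2 H -> ell2 H).
Hypothesis uw : unitary_op w ws.
Hypothesis C0 : 0 <= C.
Hypothesis bT : bounded_by C T.
Hypothesis T_upper : forall x n, T (basis_tensor x n.+1) 0 = 0.
Hypothesis T_toeplitz : forall x m n,
  T (basis_tensor (w x) n.+1) m.+1 = w (T (basis_tensor x n) m).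

(** The entry [T_m0], which plays the role of the [m]-th Fourier coefficient. *)
Definition fcoef m (x : H) : H := T (basis_tensor x 0) m.

Lemma fcoef_bounded m : bounded_by C (fcoef m).
Proof.
split=> [a x y|x]; first by rewrite /fcoef basis_tensor_linear bT.1.
by rewrite (le_trans (ell2_coord_le _ _))// (le_trans (bT.2 _))// rnorm_basis_tensor.
Qed.

(** Induction down the diagonal: [T_toeplitz] lowers both indices until the column is 0, where
    [fcoef] appears, or the row is 0, where [T_upper] gives 0. *)
Lemma toeplitz_entry x n i :
  T (basis_tensor x n) i = if (n <= i)%N then conj_iter w ws (fcoef (i - n)) n x else 0.
Proof.
case: (uw) => -[lw _] _ _ _ wsK.
elim: n i x => [|n IH] [|i] x; rewrite ?subn0// ?T_upper//.
rewrite -[x](wsK x) T_toeplitz IH ltnS subSS; case: ifP => _; last exact: lin0 lw.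
by rewrite /conj_iter [iter n.+1 w _]iterS [iter n.+1 ws _]iterSr wsK.
Qed.

Lemma toeplitz_coord g i :
  T g i = \sum_(j < i.+1) conj_iter w ws (fcoef (i - j)) j (g j).
Proof.
have b1 : bounded_by C (fun g => T g i).
  split=> [a x y|x]; first by rewrite bT.1.
  by rewrite (le_trans (ell2_coord_le _ _))// bT.2.
(* By lower triangularity the coordinate [i] of [T g] depends only on the first [i + 1] coordinates
   of [g]; this is checked on elementary tensors and makes the sum finite. *)
have b2 : bounded_by C (fun g => T (ell2_trunc i.+1 g) i).
  have [lt bt] := ell2_trunc_bounded H i.+1.
  split=> [a x y|x]; first by rewrite lt bT.1.
  rewrite (le_trans (ell2_coord_le _ _))// (le_trans (bT.2 _))// ler_wpM2l//.
  by have := bt x; rewrite mul1r.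
rewrite (eq_on_tensors C0 C0 b1 b2) => [|x n].
  rewrite (lin_sum bT.1) ell2_coord_sum; apply: eq_bigr => j _.
  by rewrite toeplitz_entry -ltnS ltn_ord.
have [ni|ni] := ltnP n i.+1.
  congr (T _ _); apply: ell2_ext => k; rewrite ell2_truncE basis_tensorE.
  by case: eqP => [->|_]; rewrite ?ni//; case: ifP.
rewrite toeplitz_entry leqNgt ni /= (_ : ell2_trunc _ _ = 0) ?(lin0 bT.1)//.
apply: ell2_ext => k; rewrite ell2_truncE; case: ifP => // ki.
by rewrite basis_tensorE ltn_eqF// (leq_trans ki ni).
Qed.

(** The Cesaro weight [1 - m / (N + 1)], cut off at 0 for [m > N] by the truncated subtraction. *)
Definition fejer_coef N m : R := (N.+1 - m)%:R / N.+1%:R.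

Definition fejer N (g : ell2 H) : ell2 H :=
  \sum_(m < N.+1) (fejer_coef N m)%:C *:
    iter m (@ushift R H) (twisted_amp w ws (fcoef m) g).

Lemma fejerE N g i : fejer N g i = \sum_(m < N.+1) (fejer_coef N m)%:C *:
  (if (m <= i)%N then conj_iter w ws (fcoef m) (i - m) (g (i - m)%N) else 0).
Proof.
rewrite ell2_coord_sum; apply: eq_bigr => m _.
rewrite ell2_coordZ iter_ushiftE; case: ifP => // _.
by rewrite (twisted_ampE uw (fcoef_bounded m)).
Qed.

(* The Fejer weight N - m counts the windows of length N that contain both
   i and i - m. *)
Lemma fejer_windows N g i : N.+1%:R%:C *: fejer N g i =
  \sum_(k < N.+1) T (ell2_window N.+1 (i + k) g) i.
Proof.
pose Y m := conj_iter w ws (fcoef m) (i - m) (g (i - m)%N) *+ (N.+1 - m).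
transitivity (\sum_(m < N.+1) if (m <= i)%N then Y m else 0).
  rewrite fejerE scaler_sumr; apply: eq_bigr => m _; rewrite scalerA -rmorphM /=.
  rewrite /fejer_coef mulrC divfK ?pnatr_eq0//.
  by case: ifP => _; rewrite ?scaler0// rmorph_nat scaler_nat.
(* Terms with [m > i] are 0 on the left, and [Y m] has multiplicity 0 for [m > N], so both sums
   reduce to the common range. *)
transitivity (\sum_(m < i.+1) Y m).
  rewrite -(big_mkord xpredT (fun m => if (m <= i)%N then Y m else 0)).
  rewrite -(big_mkord xpredT Y); have [iN|Ni] := leqP i.+1 N.+1.
    rewrite (big_cat_nat (n := i.+1))//= [X in _ + X]big_nat [X in _ + X]big1 ?addr0.
      by rewrite big_nat [RHS]big_nat; apply: eq_bigr => m /andP[_]; rewrite ltnS => ->.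
    by move=> m /andP[im _]; rewrite leqNgt im.
  rewrite [RHS](big_cat_nat (n := N.+1)) ?(ltnW Ni)//=.
  have -> : \sum_(N.+1 <= m < i.+1) Y m = 0.
    by rewrite big_nat big1// => m /andP[Nm _]; rewrite /Y (eqP Nm : (N.+1 - m = 0)%N).
  rewrite addr0 big_nat [RHS]big_nat; apply: eq_bigr => m /andP[_ mN].
  by rewrite -ltnS (ltn_trans mN Ni).
(* Substitute [m = i - j] and write the multiplicity [N + 1 - m] as a count of indices [k]. *)
transitivity (\sum_(j < i.+1) \sum_(k < N.+1)
   if (k < N.+1 - (i - j))%N then conj_iter w ws (fcoef (i - j)) j (g j) else 0).
  rewrite (reindex_inj rev_ord_inj) /=; apply: eq_bigr => j _.
  have ji : (j <= i)%N by rewrite -ltnS.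
  rewrite subSS /Y subKn// -big_mkcond /=.
  by rewrite -(big_ord_widen _ (fun=> _)) ?leq_subr// sumr_const card_ord.
rewrite exchange_big /=; apply: eq_bigr => k _; rewrite toeplitz_coord.
apply: eq_bigr => j _; rewrite ell2_windowE.
have ji : (j <= i)%N by rewrite -ltnS.
rewrite (leq_trans ji (leq_addr _ _)) /=.
have -> : (k < N.+1 - (i - j))%N = (i + k < j + N.+1)%N.
  by rewrite ltn_subRL -(ltn_add2l j) addnA subnKC.
by case: ifP => // _; rewrite (lin0 (conj_iter_bounded uw j (fcoef_bounded _)).1).
Qed.

(** Cauchy-Schwarz over the [N + 1] windows in [fejer_windows] costs one factor [N + 1], and summing
    [T] over all windows costs another; both cancel against the normalisation. *)
Lemma fejer_contract N g : rnorm (fejer N g) <= C * rnorm g.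
Proof.
apply: ell2_rnorm_le; first by rewrite mulr_ge0 ?rnorm_ge0.
move=> M; set n : R := N.+1%:R; have n0 : 0 < n by rewrite ltr0n.
pose z i k := rnorm (T (ell2_window N.+1 k g) i) ^+ 2.
have z0 i k : 0 <= z i k by rewrite sqr_ge0.
rewrite -(ler_pM2l n0) mulr_sumr.
(* Coordinate [i] uses the windows from [i] to [i + N]; for [i < M] they all lie below [M + N + 1],
   a range independent of [i]. *)
apply: (@le_trans _ _ (\sum_(0 <= i < M) \sum_(0 <= k < M + N.+1) z i k)).
  rewrite big_nat [leRHS]big_nat ler_sum// => i /andP[_ iM].
  apply: (@le_trans _ _ (\sum_(i <= k < i + N.+1) z i k)); last first.
    rewrite [leRHS](big_cat_nat (n := i)) ?(leq_trans (ltnW iM)) ?leq_addr//=.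
    rewrite [X in _ <= _ + X](big_cat_nat (n := i + N.+1)) ?leq_addr ?leq_add2r ?(ltnW iM)//=.
    by rewrite addrCA lerDl addr_ge0 ?sumr_ge0.
  rewrite -[X in \sum_(X <= _ < _) _]add0n big_addn addKn big_mkord.
  rewrite -(ler_pM2l n0) mulrA -expr2 -exprMn -[n]gtr0_norm// -rnormZr fejer_windows.
  apply: (@le_trans _ _ ((\sum_(k < N.+1) rnorm (T (ell2_window N.+1 (i + k) g) i)) ^+ 2)).
    by rewrite ler_sqr ?nnegrE ?rnorm_ge0 ?sumr_ge0 ?rnorm_sum// => k _; rewrite rnorm_ge0.
  rewrite gtr0_norm// (le_trans (sqr_sum_le _ (fun k => rnorm (T (ell2_window N.+1 (i + k) g) i))))//.
  by rewrite ler_pM2l// ler_sum// => k _; rewrite addnC.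
rewrite exchange_big /=.
apply: (@le_trans _ _ (\sum_(0 <= k < M + N.+1) C ^+ 2 * rnorm (ell2_window N.+1 k g) ^+ 2)).
  apply: ler_sum => k _; rewrite (le_trans (ell2_sum_le _ _))// -exprMn.
  by rewrite ler_sqr ?nnegrE ?rnorm_ge0 ?mulr_ge0 ?rnorm_ge0// bT.2.
rewrite -mulr_sumr exprMn mulrCA ler_wpM2l ?sqr_ge0//.
exact: sum_window_rnorm.
Qed.

Lemma fejer_linear N : linear (fejer N).
Proof.
move=> a f g; apply: ell2_ext => i.
apply: etrans (fejerE _ _ _) _; rewrite ell2_coordDZ.
apply: etrans _ (congr2 (fun x y => a *: x + y) (esym (fejerE N f i)) (esym (fejerE N g i))).
rewrite scaler_sumr -big_split /=.
apply: eq_bigr => m _; case: ifP => _; last by rewrite !scaler0 addr0.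
rewrite (conj_iter_bounded uw (i - m) (fcoef_bounded m)).1.
by rewrite scalerDr !scalerA mulrC.
Qed.

Lemma fejer_bounded N : bounded_by C (fejer N).
Proof. by split; [exact: fejer_linear|exact: fejer_contract]. Qed.

(** On a tensor in position [n] the error is the fixed vector [h] with coordinate [i] multiplied by
    [1 - fejer_coef N (i - n)]. These factors lie in [[0, 1]] and tend to 0. *)
Lemma fejer_cvg_tensor x n (e : R) : 0 < e ->
  exists N0, forall N, (N0 <= N)%N ->
    rnorm (T (basis_tensor x n) - fejer N (basis_tensor x n)) < e.
Proof.
move=> e0; set h := T (basis_tensor x n).
pose d N i : R := 1 - fejer_coef N (i - n).
have d01 N i : 0 <= d N i <= 1.
  rewrite /d /fejer_coef subr_ge0 ler_pdivrMr ?ltr0n// mul1r ler_nat leq_subr /=.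
  by rewrite gerBl divr_ge0.
pose G N : ell2 H -> ell2 H := diag_op (fun i (y : H) => (d N i)%:C *: y).
have bd N i : bounded_by 1 (fun y : H => (d N i)%:C *: y).
  have /andP[d0 d1] := d01 N i; split=> [a y z|y].
    by rewrite scalerDr !scalerA mulrC.
  by rewrite rnormZr ger0_norm// ler_wpM2r ?rnorm_ge0.
have bG N : bounded_by 1 (G N) by apply: diag_op_bounded.
have GE N f i : G N f i = (d N i)%:C *: f i by rewrite /G (diag_op_coord (bd N)).
have hG N : T (basis_tensor x n) - fejer N (basis_tensor x n) = G N h.
  apply: ell2_ext => i; rewrite GE ell2_coordB -/h.
  rewrite /d rmorphB rmorph1 scalerBl scale1r; congr (_ - _).
  rewrite fejerE /h toeplitz_entry; case: leqP => ni; last first.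
    rewrite scaler0 big1// => m _; case: ifP => mi; last by rewrite scaler0.
    rewrite basis_tensorE ltn_eqF ?(leq_ltn_trans (leq_subr _ _))//.
    by rewrite (lin0 (conj_iter_bounded uw _ (fcoef_bounded _)).1) scaler0.
  have other (m : nat) : m != (i - n)%N -> (m <= i)%N ->
      conj_iter w ws (fcoef m) (i - m) (basis_tensor x n (i - m)%N) = 0.
    move=> mn mi; rewrite basis_tensorE ifN.
      exact: (lin0 (conj_iter_bounded uw _ (fcoef_bounded _)).1).
    by apply: contra mn => /eqP <-; rewrite subKn.
  have [iN|Ni] := ltnP (i - n) N.+1; last first.
    rewrite /fejer_coef (eqP Ni : (N.+1 - (i - n) = 0)%N) mul0r scale0r big1// => m _.
    case: ifP => mi; last by rewrite scaler0.
    by rewrite other ?scaler0// ltn_eqF// (leq_trans (ltn_ord m)).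
  rewrite (bigD1 (Ordinal iN))//= leq_subr subKn// basis_tensorE eqxx big1 ?addr0// => m mi.
  case: ifP => [mi'|_]; last by rewrite scaler0.
  by rewrite other ?scaler0//; apply: contra mi => /eqP mi; apply/eqP/val_inj.
have [|N0 hN0] := strong_cvg0_ell2 ler01 bG _ h e0; last first.
  by exists N0 => N NN; rewrite hG hN0.
move=> y i d0 dpos; exists (Num.truncn (i%:R * rnorm y / d0)).+1 => N NN.
rewrite /G (diag_op_tensor (bd N)) rnorm_basis_tensor rnormZr ger0_norm; last by case/andP: (d01 N i).
have dle : d N i <= i%:R / N.+1%:R.
  have nn : (N.+1%:R : R) != 0 by rewrite pnatr_eq0.
  rewrite /d /fejer_coef -[X in X - _](divff nn).
  rewrite -mulrBl ler_pM2r ?invr_gt0 ?ltr0n// lerBlDr -natrD ler_nat.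
  by rewrite -leq_subLR leq_sub2l// leq_subr.
apply: (le_lt_trans (ler_wpM2r (rnorm_ge0 y) dle)).
rewrite mulrAC ltr_pdivrMr ?ltr0n// [ltRHS]mulrC -ltr_pdivrMr//.
rewrite (lt_le_trans (truncnS_gt _))// ler_nat; exact: leq_trans NN _.
Qed.

Lemma fejer_diff_bounded N : bounded_by (C + C) (fun g => T g - fejer N g).
Proof.
split=> [a f g|g]; first by rewrite bT.1 fejer_linear opprD addrACA scalerBr.
rewrite (le_trans (rnormD _ _))// rnormN mulrDl; apply: lerD; first exact: bT.2.
exact: fejer_contract.
Qed.

Lemma fejer_strong_cvg g (e : R) : 0 < e ->
  exists N0, forall N, (N0 <= N)%N -> rnorm (T g - fejer N g) < e.
Proof.
apply: (strong_cvg0_ell2 (addr_ge0 C0 C0) fejer_diff_bounded) => x n r r0.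
have [N0 h] := fejer_cvg_tensor x n r0; exists N0; exact: h.
Qed.
End Fejer.

(** * The structure of Ref *)

Section PowerSeries.
Variable R : realType.

Lemma geometric_sum_le (t : R) m N : 0 <= t <= 2^-1 ->
  \sum_(m <= k < N) t ^+ k <= 2 * t ^+ m.
Proof.
move=> /andP[t0 t2]; have [mN|/ltnW Nm] := leqP m N; last first.
  by rewrite big_geq// mulr_ge0// exprn_ge0.
(* The extra term [- 2 t^N] makes the induction close, because [t <= 1/2]. *)
suff : \sum_(m <= k < N) t ^+ k <= 2 * t ^+ m - 2 * t ^+ N.
  by move=> /le_trans; apply; rewrite gerBl mulr_ge0// exprn_ge0.
elim: N mN => [|N IH]; first by rewrite leqn0 => /eqP ->; rewrite big_geq// subrr.
rewrite leq_eqVlt => /predU1P[<-|]; first by rewrite big_geq// subrr.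
rewrite ltnS => mN; rewrite big_nat_recr//=; have := IH mN.
rewrite exprS; have := exprn_ge0 N t0; move: (t ^+ N) => p; nra.
Qed.

(** If the coefficients below [m] vanish, dividing by [t^m] leaves [d m] plus a remainder of size at
    most [2 D t], and [t] may tend to 0. *)
Lemma power_series_eq0 (d : nat -> R) (D : R) :
  (forall n, `|d n| <= D) ->
  (forall t, 0 < t <= 2^-1 -> forall e, 0 < e -> exists N0, forall N, (N0 <= N)%N ->
     `|\sum_(0 <= n < N) t ^+ n * d n| < e) ->
  forall n, d n = 0.
Proof.
move=> dD h; elim/ltn_ind => m IH.
have D0 : 0 <= D by exact: le_trans (normr_ge0 _) (dD 0%N).
have key t : 0 < t <= 2^-1 -> `|d m| <= 2 * D * t.
  move=> t0t; have /andP[t0 t2] := t0t; have tm0 : 0 < t ^+ m by rewrite exprn_gt0.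
  rewrite -(ler_pM2l tm0); apply: ler_eps => e e0.
  have [N0 hN0] := h _ t0t _ e0.
  have := hN0 (maxn N0 m.+1) (leq_maxl _ _); set N := maxn _ _ => hN.
  have mN : (m.+1 <= N)%N by rewrite leq_maxr.
  move: hN; rewrite (big_cat_nat (n := m.+1))//= big_nat_recr//=.
  rewrite big_nat big1 ?add0r; last by move=> k /andP[_ /IH ->]; rewrite mulr0.
  set S := \sum_(_ <= _ < _) _ => hN.
  have : `|S| <= D * (2 * t ^+ m.+1).
    rewrite (le_trans (ler_norm_sum _ _ _))//.
    apply: (@le_trans _ _ (\sum_(m.+1 <= k < N) D * t ^+ k)).
      by apply: ler_sum => k _; rewrite normrM ger0_norm ?exprn_ge0 ?(ltW t0)// mulrC ler_wpM2r// exprn_ge0// ltW.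
    by rewrite -mulr_sumr ler_wpM2l// geometric_sum_le// (ltW t0).
  have -> : t ^+ m * `|d m| = `|t ^+ m * d m + S - S|.
    by rewrite addrK normrM ger0_norm// ltW.
  have := ler_normB (t ^+ m * d m + S) S; rewrite exprS; lra.
apply/eqP; rewrite -normr_le0; apply: ler_eps => e e0; rewrite add0r.
pose t := Num.min 2^-1 (e / (2 * D + 1)).
have D1 : 0 < 2 * D + 1 by rewrite ltr_wpDl// mulr_ge0.
have t0 : 0 < t by rewrite lt_min invr_gt0 ltr0n divr_gt0.
have t2 : t <= 2^-1 by rewrite ge_min lexx.
have te : t * (2 * D + 1) <= e by rewrite -ler_pdivlMr// ge_min lexx orbT.
have := key t; rewrite t0 t2 => /(_ isT); lra.
Qed.

(** Regrouping by powers of [t] gives the coefficients [a 0] and [a n.+1 - b n]; the partial sums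
    change only by [t^N a_N], which tends to 0. *)
Lemma power_series_shift (a b : nat -> R) (B : R) :
  (forall n, `|a n| <= B) -> (forall n, `|b n| <= B) ->
  (forall t, 0 < t <= 2^-1 -> series (fun n => t ^+ n * (a n - t * b n)) @ \oo --> (0 : R)) ->
  a 0%N = 0 /\ forall n, a n.+1 = b n.
Proof.
move=> aB bB h.
pose d n := if n is m.+1 then a m.+1 - b m else a 0%N.
suff d0 n : d n = 0.
  split; first exact: (d0 0%N).
  by move=> n; apply/eqP; rewrite -subr_eq0; apply/eqP; exact: (d0 n.+1).
have B0 : 0 <= B by exact: le_trans (normr_ge0 _) (aB 0%N).
apply: (@power_series_eq0 d (B + B)) => [m|t tt e e0].
  case: m => [|m] /=; first by rewrite (le_trans (aB _))// lerDl.
  by rewrite (le_trans (ler_normB _ _))// lerD.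
have /andP[t0 t2] := tt.
have dE N : \sum_(0 <= n < N.+1) t ^+ n * d n =
    series (fun n => t ^+ n * (a n - t * b n)) N + t ^+ N * a N.
  rewrite /series /=; elim: N => [|N IH].
    by rewrite big_nat1 big_geq// add0r.
  by rewrite big_nat_recr//= IH big_nat_recr//= /d exprS; ring.
have e2 : 0 < e / 2 by rewrite divr_gt0.
have /cvgrPdist_lt/(_ _ e2)[N1 _ h1] := h _ tt.
have tc : (fun n => t ^+ n) @ \oo --> (0 : R).
  by apply: cvg_expr; rewrite gtr0_norm// (le_lt_trans t2)// invf_lt1// ltr1n.
have e3 : 0 < e / 2 / (B + 1) by rewrite divr_gt0// ltr_wpDl.
have /cvgrPdist_lt/(_ _ e3)[N2 _ h2] := tc.
exists (maxn N1 N2).+1 => -[|N]//; rewrite ltnS geq_max => /andP[n1 n2].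
rewrite dE (le_lt_trans (ler_normD _ _))// [ltRHS](splitr e) ltrD//.
  by have := h1 _ n1; rewrite /= sub0r normrN.
have := h2 _ n2; rewrite /= sub0r normrN normrM ltr_pdivlMr ?ltr_wpDl// => h3.
apply: le_lt_trans h3; rewrite ler_wpM2l// (le_trans (aB _))// lerDl//.
Qed.
End PowerSeries.

Lemma complex_small_eq0 (R : realType) (z : R[i]) :
  (forall e : R, 0 < e -> `|z| < e%:C) -> z = 0.
Proof.
move=> h; apply/eqP; rewrite -normr_le0.
have zE : `|z| = (complex.Re `|z|)%:C by rewrite normc_def.
rewrite zE lecR; apply: ler_eps => e /h; rewrite {1}zE ltcR add0r; exact: ltW.
Qed.

Section Ushift.
Variables (R : realType) (H : hilbertType R).

Lemma iter_ushift_bounded m : bounded_by 1 (iter m (@ushift R H)).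
Proof.
elim: m => [|m IH]; first by split => // x; rewrite mul1r.
split=> [a f g|f]; first rewrite iterS IH.1.
  apply: ell2_ext => n.
  rewrite -[RHS]/(a *: iter m.+1 (@ushift R H) f n + iter m.+1 (@ushift R H) g n).
  by rewrite !iterS !ushiftE; case: n => // ; rewrite scaler0 addr0.
apply: le_trans (IH.2 f); rewrite iterS; apply: ell2_rnorm_le; first exact: rnorm_ge0.
case=> [|N]; first by rewrite big_geq// sqr_ge0.
rewrite big_nat_recl// ushiftE rnorm0 expr0n add0r.
by rewrite (le_trans _ (ell2_sum_le _ N))// ler_sum// => k _; rewrite ushiftE.
Qed.

Lemma iter_ushift_tensor (x : H) m n :
  iter m (@ushift R H) (basis_tensor x n) = basis_tensor x (m + n).
Proof. by elim: m => // m IH; rewrite iterS IH ushift_basis. Qed.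
End Ushift.

Section GeometricVectors.
Variables (R : realType) (H : hilbertType R) (u : H -> H).
Hypothesis bu : bounded_by 1 u.

(** Used for [0 < t <= 2^-1], where the sequence is square-summable and geometric sums are bounded
    by 2; small [t] are enough to compare coefficients. *)
Definition geometric_vector (t : R) (eta : H) : ell2 H :=
  insubd (0 : ell2 H) (fun n => (t ^+ n)%:C *: iter n u eta).

Lemma rnorm_iter n x : rnorm (iter n u x) <= rnorm x.
Proof. by elim: n => // n IH; rewrite iterS (le_trans (bu.2 _))// mul1r. Qed.

Lemma geometric_vectorE t eta n : 0 < t <= 2^-1 ->
  geometric_vector t eta n = (t ^+ n)%:C *: iter n u eta.
Proof.
move=> /andP[t0 t2]; rewrite insubd_ell2E//.
apply: (@sq_summable_le _ _ _ (2 * rnorm eta ^+ 2)) => N.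
apply: (@le_trans _ _ (\sum_(0 <= k < N) t ^+ k * rnorm eta ^+ 2)).
  apply: ler_sum => k _; rewrite rnormZr exprMn ler_pM ?sqr_ge0//.
    have tk0 : 0 <= t ^+ k by rewrite exprn_ge0// ltW.
    rewrite ger0_norm// expr2 ger_pMl ?exprn_gt0// exprn_ile1 ?(ltW t0)//.
    by rewrite (le_trans t2)// invf_le1// ler1n.
  by rewrite ler_sqr ?nnegrE ?rnorm_ge0// rnorm_iter.
rewrite -mulr_suml ler_wpM2r ?sqr_ge0//.
rewrite (le_trans (geometric_sum_le _ _ _)) ?(ltW t0)//.
by rewrite expr0 mulr1.
Qed.
End GeometricVectors.

Section Structure.
Variables (R : realType) (C : cstarType R) (alpha : C -> C)
  (H0 : hilbertType R) (sigma : C -> H0 -> H0) (w ws : H0 -> H0).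
Hypothesis rep_sigma : star_rep sigma.
Hypothesis uw : unitary_op w ws.
Hypothesis cov : forall x xi, sigma (alpha x) xi = w (sigma x (ws xi)).

Local Notation M := (wstar_closure (lt_image alpha sigma)).

Lemma sigma_tildeE x : sigma_tilde alpha sigma x = twisted_amp w ws (sigma x).
Proof.
rewrite /sigma_tilde /twisted_amp; congr diag_op; apply/funext => n; apply/funext => xi.
elim: n xi => // n IH xi.
by rewrite /conj_iter [iter n.+1 ws _]iterSr iterS cov IH.
Qed.

Lemma sigma_tilde_bounded x : exists2 B, 0 <= B & bounded_by B (sigma_tilde alpha sigma x).
Proof.
case: rep_sigma => bs _ _ _; have [B B0 bB] := bounded_op_by (bs x).
by exists B => //; rewrite sigma_tildeE; exact: twisted_amp_bounded.
Qed.

Lemma sigma_tilde_tensor x xi n :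
  sigma_tilde alpha sigma x (basis_tensor xi n) = basis_tensor (sigma (iter n alpha x) xi) n.
Proof.
case: rep_sigma => bs _ _ _; apply: diag_op_basis => k.
have [B B0 bB] := bounded_op_by (bs (iter k alpha x)); exact: lin0 bB.1.
Qed.

Lemma orth_lt_image A f g : lt_image alpha sigma A ->
  (forall a, hdot (lt_fsum alpha sigma a f) g = 0) -> hdot (A f) g = 0.
Proof.
move=> [_ [a [_ ha]]] h; apply: complex_small_eq0 => e e0.
set c := rnorm f * rnorm g.
have c0 : 0 <= c by rewrite mulr_ge0 ?rnorm_ge0.
have e1 : 0 < e / (c + 1) by rewrite divr_gt0// ltr_wpDl.
have [k hk] := ha _ e1; have := hk k (leqnn _) f.
rewrite !rnormE -rmorphM lecR /= rnormBC => hf.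
rewrite -[hdot _ _]subr0 -(h (a k)) -hdotBl (le_lt_trans (hdot_norm_le _ _))// ltcR.
apply: (le_lt_trans (ler_wpM2r (rnorm_ge0 g) hf)); rewrite -mulrA -/c.
by rewrite mulrAC ltr_pdivrMr ?ltr_wpDl// mulrDr mulr1 ltrDl.
Qed.

(** Sequences supported at index 0 exhibit vector functionals as normal functionals. *)
Lemma normal_functional_tensor (L : hilbertType R) (f g : L) A :
  normal_functional (basis_tensor f 0) (basis_tensor g 0) A = hdot (A f) g.
Proof.
rewrite /normal_functional /csum !(@limn_series_single _ _ 0) ?basis_tensorE ?eqxx.
- by case: hdot.
- by move=> m m0; rewrite [X in hdot _ X]basis_tensorE (negPf m0) hdot0r.
- by move=> m m0; rewrite [X in hdot _ X]basis_tensorE (negPf m0) hdot0r.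
Qed.

(** Orthogonality to [g] survives norm limits, then w*-limits tested on the functional [<. f, g>],
    then the closure in the definition of [Ref]. *)
Lemma orth_Ref T f g : Ref M T ->
  (forall a, hdot (lt_fsum alpha sigma a f) g = 0) -> hdot (T f) g = 0.
Proof.
move=> [_ hT] h; apply: complex_small_eq0 => e e0.
have e1 : 0 < e / (rnorm g + 1) by rewrite divr_gt0// ltr_wpDl ?rnorm_ge0.
have /closureP_rnorm/(_ _ e1)[_ [A MA <-] TA] := hT f.
have A0 : hdot (A f) g = 0.
  apply: complex_small_eq0 => d d0.
  have [B lB] := MA.2 1%N (fun=> basis_tensor f 0) (fun=> basis_tensor g 0) d d0.
  move=> /(_ ord0); rewrite !normal_functional_tensor.
  by rewrite (orth_lt_image lB h) subr0.
rewrite -[hdot _ _]subr0 -A0 -hdotBl (le_lt_trans (hdot_norm_le _ _))// ltcR.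
move: TA; rewrite ltr_pdivlMr ?ltr_wpDl ?rnorm_ge0//; apply: le_lt_trans.
by rewrite ler_wpM2l ?rnorm_ge0// lerDl.
Qed.

(** * Relations forced on [Ref] by an intertwining contraction *)

Section Intertwiner.
Variables (u us : H0 -> H0).
Hypothesis bu : bounded_by 1 u.
Hypothesis adj : forall x y, hdot (us x) y = hdot x (u y).
Hypothesis intertw : forall x xi, us (sigma (alpha x) xi) = sigma x (us xi).

(* These vectors are orthogonal to every geometric vector of u, and so are
   their images under lt_fsum. *)
Let phi (t : R) n xi : ell2 H0 := basis_tensor xi n.+1 - basis_tensor (t%:C *: us xi) n.

Let phi_orth t n xi eta : 0 < t <= 2^-1 -> hdot (phi t n xi) (geometric_vector u t eta) = 0.
Proof.
move=> tt; rewrite hdotBl !hdot_basis_tensor !geometric_vectorE// hdotZl.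
by rewrite !hdotZrr adj mulrA -rmorphM -exprS iterS subrr.
Qed.

Let phi_lt_fsum t n xi a eta : 0 < t <= 2^-1 ->
  hdot (lt_fsum alpha sigma a (phi t n xi)) (geometric_vector u t eta) = 0.
Proof.
move=> tt; rewrite hdot_suml big1// => m _.
(* By [intertw], the [m]-th term sends [phi t n xi] to [phi t (m + n)] of
   [sigma (alpha^(n+1) a_m) xi], again orthogonal to the geometric vectors. *)
rewrite -[RHS](phi_orth (m + n) (sigma (iter n.+1 alpha a`_m) xi) eta tt).
have [B B0 bB] := sigma_tilde_bounded a`_m.
congr hdot; rewrite /phi (linB bB.1) !sigma_tilde_tensor.
rewrite (linB (iter_ushift_bounded H0 m).1) !iter_ushift_tensor addnS iterS intertw.
case: rep_sigma => bs _ _ _; have [D D0 bD] := bounded_op_by (bs (iter n alpha a`_m)).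
by rewrite (linZ bD.1).
Qed.

Lemma Ref_intertwiner T : Ref M T ->
  (forall xi n, T (basis_tensor xi n.+1) 0%N = 0) /\
  (forall xi n i, iter i.+1 us (T (basis_tensor xi n.+1) i.+1) =
     iter i us (T (basis_tensor (us xi) n) i)).
Proof.
move=> RT; have [D D0 bT] := bounded_op_by RT.1.
have iadj i x y : hdot (iter i us x) y = hdot x (iter i u y).
  by elim: i x y => // i IH x y; rewrite iterSr IH adj -iterS.
(* Moving the powers of [us] to [eta] as powers of [u] turns both claims into identities of real
   scalars. *)
suff main xi n eta :
    complex.Re (hdot (T (basis_tensor xi n.+1) 0%N) eta) = 0 /\
    forall i, complex.Re (hdot (T (basis_tensor xi n.+1) i.+1) (iter i.+1 u eta)) =
      complex.Re (hdot (T (basis_tensor (us xi) n) i) (iter i u eta)).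
  split=> [xi n|xi n i]; apply: Re_hdot_inj => eta.
    by rewrite hdot0l (main xi n eta).1.
  by rewrite !iadj; exact: (main xi n eta).2.
set g1 := T (basis_tensor xi n.+1); set g0 := T (basis_tensor (us xi) n).
pose a i := complex.Re (hdot (g1 i) (iter i u eta)).
pose b i := complex.Re (hdot (g0 i) (iter i u eta)).
have bnd (g : ell2 H0) i : `|complex.Re (hdot (g i) (iter i u eta))| <= rnorm g * rnorm eta.
  rewrite (le_trans (Re_hdot_le _ _))// ler_pM ?rnorm_ge0//; first exact: ell2_coord_le.
  exact: rnorm_iter.
apply: (@power_series_shift _ a b (rnorm g1 * rnorm eta + rnorm g0 * rnorm eta)).
- by move=> i; rewrite (le_trans (bnd _ _))// lerDl mulr_ge0 ?rnorm_ge0.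
- by move=> i; rewrite (le_trans (bnd _ _))// lerDr mulr_ge0 ?rnorm_ge0.
move=> t tt.
have z : hdot (T (phi t n xi)) (geometric_vector u t eta) = 0.
  by apply: (orth_Ref RT) => l; exact: phi_lt_fsum.
have TE : T (phi t n xi) = g1 - t%:C *: g0.
  rewrite /phi (linB bT.1); congr (_ - _).
  by rewrite (linZ (@basis_tensor_linear _ _ n)) (linZ bT.1).
(* The vanishing inner product becomes a power series in [t] of the form treated by
   [power_series_shift]. *)
have E : (fun i => complex.Re (hdot (ell2_seq (g1 - t%:C *: g0) i)
   (geometric_vector u t eta i))) = (fun i => t ^+ i * (a i - t * b i)).
  apply/funext => i; rewrite geometric_vectorE// ell2_coordB ell2_coordZ.
  rewrite hdotZrr hdotBl hdotZl /a /b.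
  by case: (hdot (g1 i) _) (hdot (g0 i) _) => p q [r s] /=; ring.
have cv := @cvg_Re_dot R H0 (g1 - t%:C *: g0) (geometric_vector u t eta).
have l0 : limn (series (fun i => complex.Re (hdot (ell2_seq (g1 - t%:C *: g0) i)
   (geometric_vector u t eta i)))) = 0.
  by have := congr1 (@complex.Re R) z; rewrite TE.
by move: cv l0; rewrite E => cv <-.
Qed.
End Intertwiner.

(** * Toeplitz form and coefficients of the operators in [Ref] *)

Section RefStructure.
Variable T : ell2 H0 -> ell2 H0.
Hypothesis RT : Ref M T.

Let ws_sigma x xi : ws (sigma (alpha x) xi) = sigma x (ws xi).
Proof. by rewrite cov; case: uw => _ _ _ ->. Qed.

Let w1 : bounded_by 1 w.
Proof. by case: (uw) => -[lw _] _ _ _ _; split => // x; rewrite (unitary_rnorm _ uw) mul1r. Qed.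

Let Ref_w := Ref_intertwiner w1 (let: And5 _ _ adj _ _ := unitary_sym uw in adj) ws_sigma RT.

Lemma Ref_upper x n : T (basis_tensor x n.+1) 0 = 0.
Proof. exact: Ref_w.1. Qed.

Lemma Ref_toeplitz x m n : T (basis_tensor (w x) n.+1) m.+1 = w (T (basis_tensor x n) m).
Proof.
case: (unitary_iter uw m) => _ _ _ _ wK; case: (uw) => _ _ _ wsK wK1.
have := Ref_w.2 (w x) n m; rewrite wsK iterSr => /(congr1 (iter m w)).
by rewrite !wK => <-; rewrite wK1.
Qed.

(* The unitary w is replaced by w b^*, where b = (1 + c / 2) / 2 is injective. *)
Lemma Ref_bicommutes m : bicommutes sigma (fcoef T m).
Proof.
move=> c cs [lc bc] [lcs bcs] adj com x.
(* The outer factor 1/2 makes [b] a contraction, and the inner one makes it injective as [1] plus an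
   operator of norm at most 1/2. *)
pose h : R := 2^-1; have h0 : 0 < h by rewrite invr_gt0.
pose b (d : H0 -> H0) y := h%:C *: (y + h%:C *: d y).
have bb d : linear d -> (forall y, rnorm (d y) <= 1 * rnorm y) -> bounded_by 1 (b d).
  move=> ld bd; split=> [a y z|y].
    rewrite /b ld [h%:C *: (_ + d z)]scalerDr addrACA [LHS]scalerDr; congr (_ + _).
    by rewrite !scalerDr !scalerA; congr (_ *: _ + _ *: _); ring.
  rewrite rnormZr mul1r gtr0_norm//; have := rnormD y (h%:C *: d y).
  rewrite rnormZr gtr0_norm//; have := bd y; rewrite mul1r.
  have := rnorm_ge0 y; rewrite /h; lra.
have [bl b1] := bb _ lc bc; have [bsl bs1] := bb _ lcs bcs.
have b_inj y z : b c y = b c z -> y = z.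
  move=> /eqP; rewrite -subr_eq0 -(linB bl) => /eqP b0.
  apply/eqP; rewrite -subr_eq0; move: (y - z) b0 => v b0.
  have : v + h%:C *: c v = 0.
    move/eqP: b0; rewrite scaler_eq0 => /orP[/eqP[h00]|/eqP//].
    by move: h0; rewrite h00 ltxx.
  move=> /eqP; rewrite addr_eq0 => /eqP vE.
  have := rnorm_ge0 v; have := bc v; rewrite mul1r.
  have : rnorm v = h * rnorm (c v) by rewrite {1}vE rnormN rnormZr gtr0_norm.
  move=> h1 h2 h3; apply/eqP/rnorm0_eq0; rewrite /h in h1; lra.
have adjb y z : hdot (b c y) z = hdot y (b cs z).
  by rewrite /b hdotZl hdotDl hdotZl adj hdotZrr hdotDr hdotZrr.
have comb y z : b c (sigma y z) = sigma y (b c z).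
  case: rep_sigma => bs _ _ _; have [D D0 bD] := bounded_op_by (bs y).
  by rewrite /b com (linZ bD.1) (linD bD.1) (linZ bD.1).
have [lw bw] := w1.
case: (uw) => _ _ _ wsK wK1; case: (unitary_sym uw) => _ _ adjw _ _.
have bu : bounded_by 1 (w \o b cs).
  split; first exact: linear_comp.
  by move=> y /=; rewrite (le_trans (bw _))// mul1r.
have adju y z : hdot ((b c \o ws) y) z = hdot y ((w \o b cs) z) by rewrite /= adjb adjw.
have intu y xi : (b c \o ws) (sigma (alpha y) xi) = sigma y ((b c \o ws) xi).
  by rewrite /= ws_sigma comb.
(* With [us = b ws] and the Toeplitz relation this reads [us^m (b a_m x) = us^m (a_m b x)], and
   [us^m] is injective. *)
have [_ /(_ (w x) 0%N m)] := Ref_intertwiner bu adju intu RT.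
rewrite iterSr /= Ref_toeplitz !wsK.
have iinj : injective (iter m (b c \o ws)).
  elim: m => [|k IH] y z //; rewrite !iterS => /b_inj /(can_inj wK1); exact: IH.
move=> /iinj; rewrite -/(fcoef T m x) -/(fcoef T m (b c x)).
have [D D0 bT] := bounded_op_by RT.1.
have [lf _] := fcoef_bounded bT m.
rewrite /b (linZ lf) (linD lf) (linZ lf).
have hn0 : h%:C != 0 :> R[i] by apply/eqP => -[] h00; move: h0; rewrite h00 ltxx.
by move=> /(scalerI hn0)/addrI/(scalerI hn0).
Qed.

(** Every [sigma a] kills [y = x - sigma cone x], so every finite sum kills [y (x) e_0], and
    [orth_Ref] against arbitrary vectors makes [T] kill it. *)
Lemma Ref_nondegenerate m x : fcoef T m (sigma cone x) = fcoef T m x.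
Proof.
have [D D0 bT] := bounded_op_by RT.1; have [lf _] := fcoef_bounded bT m.
case: rep_sigma => bs _ ms _.
apply/esym/eqP; rewrite -subr_eq0 -(linB lf); set y := x - _.
have y0 a : sigma a y = 0.
  have [B B0 bB] := bounded_op_by (bs a).
  by rewrite /y (linB bB.1) -ms cmul1r subrr.
rewrite /fcoef; suff -> : T (basis_tensor y 0) = 0 by [].
apply: Re_hdot_inj => g; rewrite hdot0l (orth_Ref RT) // => a.
rewrite hdot_suml big1// => k _.
rewrite sigma_tilde_tensor y0 (lin0 (@basis_tensor_linear _ _ _)).
by rewrite (lin0 (iter_ushift_bounded H0 k).1) hdot0l.
Qed.
End RefStructure.
End Structure.

(** * Approximation by the image of the semicrossed product *)

Section Amplification.
Variable R : realType.

Lemma unitary_id (H : hilbertType R) : unitary_op (@id H) id.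
Proof.
have b : bounded_op (@id H).
  by apply: (@bounded_by_op _ _ _ 1); split => // x; rewrite mul1r.
by split.
Qed.

(** The case [w = id] of [twisted_amp], so that the results on representations and bicommutants
    apply to it. *)
Definition amp (H : hilbertType R) (B : H -> H) : ell2 H -> ell2 H := twisted_amp id id B.

Lemma ampE (H : hilbertType R) (D : R) (B : H -> H) f n : bounded_by D B -> amp B f n = B (f n).
Proof.
move=> bB; rewrite (twisted_ampE (@unitary_id H) bB) /conj_iter.
have it (x : H) : iter n id x = x by elim: n => //= n ->.
by rewrite !it.
Qed.

Lemma amp_bounded (H : hilbertType R) (D : R) (B : H -> H) : 0 <= D -> bounded_by D B ->
  bounded_by D (amp B).
Proof. by move=> D0 bB; apply: twisted_amp_bounded => //; exact: unitary_id. Qed.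

Lemma amp_sum (H : hilbertType R) (D E : R) (S T : H -> H) n (c : nat -> R[i]) (Z : nat -> H -> H) :
  bounded_by D S -> bounded_by E T -> (forall m, exists F, bounded_by F (Z m)) ->
  (forall x, S x - T x = \sum_(m < n) c m *: Z m x) ->
  forall f, amp S f - amp T f = \sum_(m < n) c m *: amp (Z m) f.
Proof.
move=> bS bT bZ h f; apply: ell2_ext => i.
rewrite ell2_coordB (ampE _ _ bS) (ampE _ _ bT) h ell2_coord_sum; apply: eq_bigr => m _.
by have [F bF] := bZ m; rewrite ell2_coordZ (ampE _ _ bF).
Qed.

Lemma amp_sub_mono (H : hilbertType R) (D E F G : R) (S T S' T' : H -> H) :
  bounded_by D S -> bounded_by E T -> bounded_by F S' -> bounded_by G T' ->
  (forall x, rnorm (S x - T x) <= rnorm (S' x - T' x)) ->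
  forall f, rnorm (amp S f - amp T f) <= rnorm (amp S' f - amp T' f).
Proof.
move=> bS bT bS' bT' h f; apply: ell2_rnorm_mono => i.
by rewrite !ell2_coordB (ampE _ _ bS) (ampE _ _ bT) (ampE _ _ bS') (ampE _ _ bT').
Qed.

Lemma amp_coord_sub (H : hilbertType R) (D E : R) (S T : H -> H) (f : ell2 H) n :
  bounded_by D S -> bounded_by E T ->
  rnorm (S (f n) - T (f n)) <= rnorm (amp S f - amp T f).
Proof.
move=> bS bT; apply: le_trans (ell2_coord_le _ n).
by rewrite ell2_coordB (ampE _ _ bS) (ampE _ _ bT).
Qed.

Lemma amp_sub (H : hilbertType R) (D E F : R) (S T G : H -> H) :
  bounded_by D S -> bounded_by E T -> bounded_by F G ->
  (forall x, S x - T x = G x) -> forall f, amp S f - amp T f = amp G f.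
Proof.
move=> bS bT bG h f; apply: ell2_ext => i.
by rewrite ell2_coordB (ampE _ _ bS) (ampE _ _ bT) (ampE _ _ bG).
Qed.

Lemma amp_coord_le (H : hilbertType R) (D : R) (S : H -> H) (f : ell2 H) n :
  bounded_by D S -> rnorm (S (f n)) <= rnorm (amp S f).
Proof. by move=> bS; rewrite -(ampE f n bS) ell2_coord_le. Qed.

Definition strong_cvg0 (H K : hilbertType R) (G : nat -> H -> K) : Prop :=
  forall f (e : R), 0 < e -> exists N0, forall N, (N0 <= N)%N -> rnorm (G N f) < e.

(** The uniform bound reduces the claim to elementary tensors: bounded strong convergence is
    ultrastrong convergence. *)
Lemma amp_strong_cvg0 (H : hilbertType R) (D : R) (G : nat -> H -> H) : 0 <= D ->
  (forall N, bounded_by D (G N)) -> strong_cvg0 G -> strong_cvg0 (fun N => amp (G N)).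
Proof.
move=> D0 bG cG; apply: (strong_cvg0_ell2 D0) => [N|x n e /(cG x)[N0 hN0]].
  exact: amp_bounded.
exists N0 => N /hN0; congr (_ < _).
rewrite -[LHS](rnorm_basis_tensor _ n); congr rnorm.
apply: ell2_ext => k; rewrite (ampE _ _ (bG N)) !basis_tensorE.
by case: eqP => // _; rewrite (lin0 (bG N).1).
Qed.
End Amplification.

(** * From [Ref] to the w*-closure *)

Section Approximation.
Variables (R : realType) (C : cstarType R) (alpha : C -> C)
  (H0 : hilbertType R) (sigma : C -> H0 -> H0) (w ws : H0 -> H0).
Hypothesis rep_sigma : star_rep sigma.
Hypothesis uw : unitary_op w ws.
Hypothesis cov : forall x xi, sigma (alpha x) xi = w (sigma x (ws xi)).

Lemma bounded_by_sum (K : hilbertType R) (n : nat) (F : nat -> K -> K) :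
  (forall m, exists2 D : R, 0 <= D & bounded_by D (F m)) ->
  exists2 D : R, 0 <= D & bounded_by D (fun f => \sum_(m < n) F m f).
Proof.
move=> bF; elim: n => [|n [D D0 [lD bD]]].
  by exists 0 => //; split=> [a x y|x]; rewrite !big_ord0 ?scaler0 ?addr0// rnorm0 mul0r.
have [E E0 [lE bE]] := bF n; exists (D + E); first exact: addr_ge0.
split=> [a x y|x]; rewrite !big_ord_recr /=.
  by rewrite [X in X + _]lD lE addrACA scalerDr.
by rewrite (le_trans (rnormD _ _))// mulrDl lerD.
Qed.

Lemma lt_fsum_bounded a : exists2 D : R, 0 <= D & bounded_by D (lt_fsum alpha sigma a).
Proof.
apply: (@bounded_by_sum _ _ (fun m f => iter m (@ushift R H0) (sigma_tilde alpha sigma a`_m f))).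
move=> m; have [D D0 [lD bD]] := sigma_tilde_bounded rep_sigma uw cov a`_m.
have [lu bu] := iter_ushift_bounded H0 m.
exists D => //; split=> [b f g|f]; first by rewrite lD lu.
by rewrite (le_trans (bu _))// mul1r.
Qed.

Lemma lt_fsum_image a : lt_image alpha sigma (lt_fsum alpha sigma a).
Proof.
have [D D0 bD] := lt_fsum_bounded a.
split; first exact: bounded_by_op bD.
(* The constant sequence works: all entries of [fsum_sub a a] are 0. *)
exists (fun=> a); split=> e e0; exists 0%N; last first.
  by move=> k _ f; rewrite subrr normr0 mulr_ge0// ler0c ltW.
move=> _ _ _ _ K pi T' [[_ lpi _ _] [lT _] _] xi.
rewrite /integrated big1 ?normr0 ?mulr_ge0 ?ler0c ?(ltW e0)// => m _.
have -> : (fsum_sub a a)`_m = 0.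
  have mn : (m < maxn (size a) (size a))%N 
    by apply: leq_trans (ltn_ord m) _; rewrite size_mkseq.
  by rewrite /fsum_sub nth_mkseq// subrr.
have -> : pi 0 xi = 0.
  by have := lpi (-1) 0 0 xi; rewrite scaler0 addr0 scaleN1r addNr.
by elim: (nat_of_ord m) => // k IH; rewrite iterS IH (lin0 lT).
Qed.

(** Normal functionals are vector functionals of the amplification, so w*-approximation follows from
    norm approximation at vectors of the amplified space. *)
Lemma normal_functionalE (L : hilbertType R) (D : R) (xi eta : ell2 L) (T : L -> L) :
  bounded_by D T -> normal_functional xi eta T = hdot (amp T xi) eta.
Proof. by move=> bT; congr csum; apply/funext => i; rewrite (ampE _ _ bT). Qed.

(** Besides the grading inside [sigma_tilde], the inner amplification carries the sequence of
    vectors of one normal functional, and the outer one carries finitely many functionals at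
    once. *)
Let pi3 x := amp (amp (sigma_tilde alpha sigma x)).

(** Both hypotheses of [bicommutant_density] lift through the twisted amplification and the two
    plain ones. *)
Lemma density_fcoef (A : H0 -> H0) : bounded_op A -> bicommutes sigma A ->
  (forall x, A (sigma cone x) = A x) ->
  forall zeta (e : R), 0 < e ->
    exists x, rnorm (amp (amp (twisted_amp w ws A)) zeta - pi3 x zeta) < e.
Proof.
move=> bA biA A1; have [D D0 bD] := bounded_op_by bA.
have r1 := star_rep_twisted uw rep_sigma.
have r2 := star_rep_twisted (@unitary_id _ _) r1.
have r3 := star_rep_twisted (@unitary_id _ _) r2.
have b1 := twisted_amp_bounded uw D0 bD.
have b2 := amp_bounded D0 b1.
have c1 := bicommutes_twisted uw (let: And4 h _ _ _ := rep_sigma in h) bA biA.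
have c2 := bicommutes_twisted (@unitary_id _ _) (let: And4 h _ _ _ := r1 in h)
  (bounded_by_op b1) c1.
have c3 := bicommutes_twisted (@unitary_id _ _) (let: And4 h _ _ _ := r2 in h)
  (bounded_by_op b2) c2.
have pE : pi3 = (fun x => amp (amp (twisted_amp w ws (sigma x)))).
  by apply/funext => x; rewrite /pi3 (sigma_tildeE cov).
rewrite pE; apply: (bicommutant_density r3 c3) => f.
have [E E0 bE] : exists2 E, 0 <= E & bounded_by E (sigma cone).
  by apply: bounded_op_by; case: rep_sigma.
have e1 := twisted_amp_bounded uw E0 bE; have e2 := amp_bounded E0 e1.
apply: (twisted_amp_absorb (@unitary_id _ _) b2 e2).
apply: (twisted_amp_absorb (@unitary_id _ _) b1 e1).
exact: (twisted_amp_absorb uw bD bE).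
Qed.

Lemma sigma_tildeZ b x f :
  sigma_tilde alpha sigma (b *: x) f = b *: sigma_tilde alpha sigma x f.
Proof.
rewrite !(sigma_tildeE cov); case: (star_rep_twisted uw rep_sigma) => _ l1 _ _.
have := l1 b x 0 f; rewrite addr0 => ->.
have -> : twisted_amp w ws (sigma 0) f = 0; last by rewrite addr0.
by have := l1 (-1) 0 0 f; rewrite scaler0 addr0 scaleN1r addNr.
Qed.

Lemma Ref_wstar_closure T : Ref (wstar_closure (lt_image alpha sigma)) T ->
  wstar_closure (lt_image alpha sigma) T.
Proof.
move=> RT; split; first exact: RT.1.
move=> n xi eta e e0; have [D D0 bT] := bounded_op_by RT.1.
have up := Ref_upper rep_sigma uw cov RT.
have toep := Ref_toeplitz rep_sigma uw cov RT.
(* An error of [2 d = e / (s + 1)] at each [xi j], paired with [eta j] of norm at most [s], stays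
   below [e]. *)
pose s := \sum_(j < n) rnorm (eta j).
have s0 : 0 <= s by rewrite sumr_ge0// => j _; exact: rnorm_ge0.
pose d := e / 2 / (s + 1).
have d0 : 0 < d by rewrite !divr_gt0// ltr_wpDl.
(* All [xi j] are packed into one vector, so that one [N] and one family [x] serve every
   functional. *)
pose zeta : ell2 (ell2 (ell2 H0)) := \sum_(j < n) basis_tensor (xi j) j.
have zE (j : 'I_n) : zeta j = xi j by exact: sum_basis_tensorE.
pose G N f := T f - fejer w ws T N f.
have DD0 : 0 <= D + D by rewrite addr_ge0.
have bG N : bounded_by (D + D) (G N) by exact: fejer_diff_bounded.
have G0 : strong_cvg0 G by move=> f r r0; exact: (fejer_strong_cvg uw D0 bT up toep f r0).
have bG2 N := amp_bounded DD0 (bG N).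
have [N /(_ N (leqnn _)) hN] :=
  amp_strong_cvg0 DD0 bG2 (amp_strong_cvg0 DD0 bG G0) zeta d0.
(* The error [d] is shared among the [N + 1] coefficients of the Fejer mean. *)
have dN0 : 0 < d / N.+1%:R by rewrite divr_gt0// ltr0n.
have appr m : exists y, rnorm
    (amp (amp (twisted_amp w ws (fcoef T m))) zeta - pi3 y zeta) < d / N.+1%:R.
  apply: density_fcoef dN0.
  - exact: bounded_by_op (fcoef_bounded bT m).
  - exact: (@Ref_bicommutes _ _ _ _ _ _ _ rep_sigma uw cov _ RT m).
  - exact: (Ref_nondegenerate rep_sigma RT).
have [x hx] := choice appr.
pose a := mkseq (fun m => (fejer_coef R N m)%:C *: x m) N.+1.
exists (lt_fsum alpha sigma a); first exact: lt_fsum_image.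
move=> j; have [A A0 bA] := lt_fsum_bounded a.
rewrite (normal_functionalE _ _ bT) (normal_functionalE _ _ bA) -hdotBl.
rewrite (le_lt_trans (hdot_norm_le _ _))// ltcR.
suff key : rnorm (amp T (xi j) - amp (lt_fsum alpha sigma a) (xi j)) <= d + d.
  apply: (le_lt_trans (ler_wpM2r (rnorm_ge0 _) key)).
  have -> : d + d = e / (s + 1) by rewrite /d -mulrDl -splitr.
  rewrite mulrAC ltr_pdivrMr ?ltr_wpDl// ltr_pM2l//.
  rewrite (@le_lt_trans _ _ s) ?ltrDl// /s (bigD1 j)//= lerDl sumr_ge0// => i _.
  exact: rnorm_ge0.
have bF : bounded_by D (fejer w ws T N) := fejer_bounded uw D0 bT up toep N.
(* One [d] pays for passing from [T] to its Fejer mean, the other for replacing the coefficients by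
   elements of [sigma(C)]. *)
apply: (le_trans (rnorm_tri (amp (fejer w ws T N) (xi j)) _ _)); apply: lerD.
  rewrite (amp_sub bT bF (bG N) (fun=> erefl)) -zE.
  exact: le_trans (amp_coord_le zeta j (bG2 N)) (ltW hN).
pose Dm m := twisted_amp w ws (fcoef T m).
have bD m : bounded_by D (Dm m) by exact: twisted_amp_bounded (fcoef_bounded bT m).
pose Sm m := sigma_tilde alpha sigma (x m).
have bS m : exists2 E, 0 <= E & bounded_by E (Sm m) := sigma_tilde_bounded rep_sigma uw cov (x m).
have diff_small m : rnorm (amp (Dm m) (xi j) - amp (Sm m) (xi j)) <= d / N.+1%:R.
  have [S S0 bSm] := bS m; rewrite -zE.
  exact: le_trans (amp_coord_sub zeta j (amp_bounded D0 (bD m)) (amp_bounded S0 bSm)) (ltW (hx m)).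
pose V m := iter m (@ushift R H0).
have bV m : bounded_by 1 (V m) := iter_ushift_bounded H0 m.
have bVc m (S : R) (B : ell2 H0 -> ell2 H0) : bounded_by S B -> bounded_by S (V m \o B).
  move=> [lB bB]; split; first exact: linear_comp (bV m).1 lB.
  by move=> f /=; rewrite (le_trans ((bV m).2 _))// mul1r.
pose Z m f := (V m \o Dm m) f - (V m \o Sm m) f.
have bZ m : exists E, bounded_by E (Z m).
  have [S S0 bSm] := bS m; have [lD bD'] := bVc m _ _ (bD m).
  have [lS bS'] := bVc m _ _ bSm; exists (D + S).
  split=> [b f g|f]; first by rewrite /Z lD lS opprD addrACA scalerBr.
  by rewrite (le_trans (rnormD _ _))// rnormN mulrDl lerD.
have diffE f : fejer w ws T N f - lt_fsum alpha sigma a f =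
    \sum_(m < N.+1) (fejer_coef R N m)%:C *: Z m f.
  rewrite /fejer /lt_fsum /integrated size_mkseq -sumrB; apply: eq_bigr => m _.
  rewrite /Z /comp scalerBr; congr (_ - _).
  rewrite nth_mkseq// -(linZ (bV m).1); congr (V m _).
  exact: sigma_tildeZ.
rewrite (amp_sum (c := fun m => (fejer_coef R N m)%:C) bF bA bZ diffE).
rewrite (le_trans (rnorm_sum _ _ _))//.
apply: (@le_trans _ _ (\sum_(m < N.+1) d / N.+1%:R)); last first.
  by rewrite sumr_const card_ord -[_ *+ _]mulr_natr divfK// pnatr_eq0.
apply: ler_sum => m _; apply: (le_trans _ (diff_small m)).
have /andP[c0 c1] : 0 <= fejer_coef R N m <= 1.
  by rewrite /fejer_coef divr_ge0//= ler_pdivrMr ?ltr0n// mul1r ler_nat leq_subr.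
rewrite rnormZr ger0_norm//.
apply: (@le_trans _ _ (rnorm (amp (Z m) (xi j)))).
  by rewrite ler_piMl ?rnorm_ge0.
have [S S0 bSm] := bS m; have [E bE] := bZ m.
rewrite -(amp_sub (bVc m _ _ (bD m)) (bVc m _ _ bSm) bE (fun=> erefl)).
(* The powers of the shift are contractions, so they drop out of the estimate. *)
apply: (amp_sub_mono (bVc m _ _ (bD m)) (bVc m _ _ bSm) (bD m) bSm) => f /=.
by rewrite -(linB (bV m).1) (le_trans ((bV m).2 _))// mul1r.
Qed.
End Approximation.

Theorem mainTheorem8 (R : realType) (C : cstarType R) (alpha : C -> C)
    (H0 : hilbertType R) (sigma : C -> H0 -> H0) (w ws : H0 -> H0) :
  star_morphism alpha ->
  star_rep sigma ->
  injective sigma ->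
  unitary_op w ws ->
  (forall x xi, sigma (alpha x) xi = w (sigma x (ws xi))) ->
  reflexive_space (wstar_closure (lt_image alpha sigma)).
Proof.
move=> _ rep_sigma _ uw cov; apply/seteqP; split=> T.
  (* Every space of bounded operators lies in its [Ref]; the content is the converse inclusion. *)
  move=> MT; split; first exact: MT.1.
  by move=> xi; apply: subset_closure; exists T.
exact: (Ref_wstar_closure rep_sigma uw cov).
Qed.
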